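(* Let $q=p^k$ with $p$ prime and $k\ge 1$, let $1\le s\le q$, and let $\boldsymbol{\gamma}=\{\gamma_{\mathfrak{u}} : \emptyset\neq\mathfrak{u}\subseteq[s]\}$ be any set of non-negative real weights. (i) If $\mathcal{P}_s$ is a set of explicit inversive points of size $q$, then $$D_{q,\boldsymbol{\gamma}}^*(\mathcal{P}_s)\le \max_{\emptyset\ne\mathfrak{u}\subseteq[s]}\gamma_{\mathfrak{u}}|\mathfrak{u}|\left(\frac1q+\frac{3\,\mathcal{T}(q,|\mathfrak{u}|)}{q^{1/2}}\right).$$ (ii) If $\mathcal{P}_s$ is a set of explicit inversive points of period $T$, then $$D_{T,\boldsymbol{\gamma}}^*(\mathcal{P}_s)\le \max_{\emptyset\ne\mathfrak{u}\subseteq[s]}\gamma_{\mathfrak{u}}|\mathfrak{u}|\left(\frac1q+\frac{3\,\mathcal{T}(q,|\mathfrak{u}|)\,q^{1/2}}{T}\right).$$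
   Context: Notation: $[s]=\{1,\dots,s\}$. $\mathbb{F}_q$ is the finite field with $q=p^k$ elements, and $\{\beta_1,\dots,\beta_k\}$ is a fixed (arbitrary) ordered basis of $\mathbb{F}_q$ over $\mathbb{F}_p$. Digital point set. Given $\boldsymbol{z}_0,\dots,\boldsymbol{z}_{N-1}\in\mathbb{F}_q^s$, write $\boldsymbol{z}_n=\boldsymbol{c}_n^{(1)}\beta_1+\cdots+\boldsymbol{c}_n^{(k)}\beta_k$ with $\boldsymbol{c}_n^{(j)}\in\mathbb{F}_p^s$, identify $\mathbb{F}_p$ with $\{0,1,\dots,p-1\}$, and put $\boldsymbol{x}_n=\sum_{j=1}^k\boldsymbol{c}_n^{(j)}p^{-j}\in[0,1)^s$. The derived point set is $\mathcal{P}_s=\{\boldsymbol{x}_0,\dots,\boldsymbol{x}_{N-1}\}$ (points counted with multiplicity). For $z\in\mathbb{F}_q$ put $\overline{z}=z^{-1}$ if $z\neq0$ and $\overline{0}=0$. Let $S=\{v_1,\dots,v_s\}\subseteq\mathbb{F}_q$ be any subset of cardinality $s$, $1\le s\le q$. Set of explicit inversive points of size $q$: the digital point set derived from the $N=q$ vectors $(\overline{u+v_1},\dots,\overline{u+v_s})$, $u\in\mathbb{F}_q$. Set of explicit inversive points of period $T$: let $0\neq\theta\in\mathbb{F}_q$ have multiplicative order $T$ (so $T\mid q-1$); it is the digital point set derived from the $N=T$ vectors $(\overline{\theta^n+v_1},\dots,\overline{\theta^n+v_s})$, $n=0,\dots,T-1$. Weighted star discrepancy. For an $N$-element point set $\mathcal{P}_s$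 in $[0,1)^s$ and $\boldsymbol{\alpha}\in[0,1]^s$, let $\Delta_{\mathcal{P}_s}(\boldsymbol{\alpha})=\frac{|\mathcal{P}_s\cap[\boldsymbol{0},\boldsymbol{\alpha})|}{N}-\prod_{i=1}^s\alpha_i$. Then $$D^*_{N,\boldsymbol{\gamma}}(\mathcal{P}_s)=\max_{\emptyset\ne\mathfrak{u}\subseteq[s]}\gamma_{\mathfrak{u}}\sup_{\boldsymbol{\alpha}\in[0,1]^s}|\Delta_{\mathcal{P}_s}((\boldsymbol{\alpha}_{\mathfrak{u}},\boldsymbol{1}))|,$$ where $(\boldsymbol{\alpha}_{\mathfrak{u}},\boldsymbol{1})$ has $j$th coordinate $\alpha_j$ if $j\in\mathfrak{u}$ and $1$ if $j\notin\mathfrak{u}$. Auxiliary function: for $q=p^k$ and $r\ge1$, $\mathcal{T}(q,r)=\left(\frac k2+1\right)^r$ if $p=2$, and $\mathcal{T}(q,r)=\left(\frac2\pi\log p+\frac75\right)^r k^r$ if $p>2$. *)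

(* Defs.v *)
(* MathComp / MathComp-Analysis development. *)
From HB Require Import structures.
From mathcomp Require Import all_boot all_order all_algebra all_field.
From mathcomp Require Import all_classical all_reals all_analysis.
Set Implicit Arguments.
Unset Strict Implicit.
Unset Printing Implicit Defensive.
Import Order.TTheory GRing.Theory Num.Theory.
Local Open Scope ring_scope.

(* Point sets are finite families of points (so points are counted with
   multiplicity): the index type I has N = #|I| elements, and the s
   coordinates [s] are indexed by 'I_s. *)

Section Discrepancy.
Context {R : realType} {I : finType} {s : nat}.
Implicit Types (P : I -> 'rV[R]_s) (a : 'rV[R]_s) (u : {set 'I_s}).

Definition unit_cube : set 'rV[R]_s := [set a | forall i, 0 <= a 0 i <= 1]%classic.

Definition local_discrepancy P a : R :=
  #|[set n : I | [forall i, 0 <= P n 0 i < a 0 i]]|%:R / #|I|%:R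
  - \prod_(i < s) a 0 i.

(* (alpha_u, 1) *)
Definition anchor u a : 'rV[R]_s := \row_j (if j \in u then a 0 j else 1).

(* The maximum over the nonempty u is taken with default value 0, which is
   harmless for non-negative weights and s >= 1; gamma set0 is never used. *)
Definition weighted_star_discrepancy (gamma : {set 'I_s} -> R) P : R :=
  \big[Num.max/0]_(u : {set 'I_s} | u != finset.set0)
    (gamma u *
     sup [set `|local_discrepancy P (anchor u a)| | a in unit_cube]%classic).

End Discrepancy.

(* The coordinates of z in the basis b live in 'F_p = {0, ..., p-1}, and b is
   indexed from 0, whence the exponent j.+1. *)
Definition digital_coord (R : realType) (p k : nat) (L : vectType 'F_p)
    (b : k.-tuple L) (z : L) : R :=
  \sum_(j < k) (coord b j z : nat)%:R / p%:R ^+ j.+1.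

Definition digital_points (R : realType) (p k s : nat) (L : vectType 'F_p)
    (b : k.-tuple L) (I : finType) (z : I -> 'rV[L]_s) : I -> 'rV[R]_s :=
  fun n => \row_i digital_coord R b (z n 0 i).

(* The field inverse satisfies 0^-1 = 0, so it is the required map on all of
   F. *)
Definition inversive_vector (F : fieldType) (s : nat) (v : 'I_s -> F) (u : F) :
  'rV[F]_s := \row_i (u + v i)^-1.

(* T(q, r) for q = p ^ k *)
Definition Tfun (R : realType) (p k r : nat) : R :=
  if p == 2 then (k%:R / 2 + 1) ^+ r
  else (2 / pi * ln p%:R + 7 / 5) ^+ r * k%:R ^+ r.

Section InversivePoints.
Context (R : realType) (F : finFieldType) (p k s : nat).
Context (charF : p \in [pchar F]).
(* pPrimeCharType charF is F itself, viewed as a vector space over 'F_p. *)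
Context (b : k.-tuple (pPrimeCharType charF)) (v : 'I_s -> F).

Definition inversive_points : F -> 'rV[R]_s :=
  digital_points R b (fun u : F => inversive_vector v u).

Definition inversive_points_period (theta : F) (T : nat) : 'I_T -> 'rV[R]_s :=
  digital_points R b (fun n : 'I_T => inversive_vector v (theta ^+ n)).

End InversivePoints.

(* Main.v *)
(* Walsh expansion of the indicator functions of boxes reduces the discrepancy to
   the sums of psi (sum_i h_i / (u + v_i)) over u, or over the subgroup generated
   by theta; the latter is an average of sums twisted by multiplicative
   characters chi. Each twisted sum is the first power sum of the reciprocal
   roots of an L-function: chi and psi define a completely multiplicative function
   of monic polynomials g through g(0) and the logarithmic derivatives g'/g at
   the points -v_i, and its sum over the monic polynomials of degree n vanishes
   once n exceeds twice the number of poles. The reciprocal roots are at most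
   sqrt q in modulus, because Stepanov's method, applied over every extension of
   even degree, bounds their power sums. All extensions of the field F are taken
   inside one algebraic closure K, as fixed points of powers of Frobenius. *)
Require Import Defs.
From HB Require Import structures.
From mathcomp Require Import all_boot all_order all_algebra all_field.
From mathcomp Require Import all_classical all_reals all_analysis.
From mathcomp Require Import cyclic complex.
From mathcomp Require Import zify ring lra.
Set Implicit Arguments.
Unset Strict Implicit.
Unset Printing Implicit Defensive.
Import Order.TTheory GRing.Theory Num.Theory.
Import numFieldNormedType.Exports.
Local Open Scope ring_scope.

(** * Stepanov's method *)

(** Stepanov's method gives upper estimates only, for the number of points with a prescribed trace.
    Even degree matters because the trace over a field with [M * M] elements is [U + U ^+ M], where
    [U] is its lower half: prescribing the trace [c] means [U ^+ M = c - U], a relation of low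
    degree. The auxiliary polynomial enters through its [M]-th power, so no derivatives are needed
    in characteristic [p]. The points are sorted by norm and trace. All [p * q.-1] classes receive
    the same upper estimate and together they make up almost all of the field, so no class can be
    much smaller than the estimate; since the [p]-th roots of unity sum to zero, only [O(M)] remains
    of the character sum. The constant 3: with [m] poles the L-function has degree at most [2 m],
    which gives [2 m sqrt q]. The remaining [m sqrt q] pays for the points at the poles, where the
    convention [0^-1 = 0] leaves terms of modulus at most 1. *)

Lemma poly_dependent (K : fieldType) (J : finType) (n : nat)
    (E : J -> {poly K}) :
  (forall j, (size (E j) <= n)%N) -> (n < #|J|)%N ->
  exists2 t : J -> K, (exists j, t j != 0) & \sum_j t j *: E j = 0.
Proof.
move=> sE ltn.
pose A : 'M[K]_(#|J|, n) := \matrix_(i, k) (E (enum_val i))`_k.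
have kA0 : kermx A != 0.
  rewrite -mxrank_eq0 mxrank_ker subn_eq0 -ltnNge.
  exact: leq_ltn_trans (rank_leq_col _) ltn.
have /rowV0Pn[v /sub_kermxP vA v0] := kA0.
exists (fun j => v 0 (enum_rank j)).
  have /rV0Pn[i vi] := v0.
  by exists (enum_val i); rewrite enum_valK.
apply/polyP=> k; rewrite coef0 coef_sum.
have [ltk|lek] := ltnP k n; last first.
  apply: big1 => j _; rewrite coefZ nth_default ?mulr0 //.
  exact: leq_trans (sE j) lek.
have /rowP/(_ (Ordinal ltk)) := vA; rewrite !mxE => vk.
rewrite -[RHS]vk [RHS](reindex (@enum_rank J)) /=; last exact: onW_bij (enum_rank_bij J).
by apply: eq_bigr => j _; rewrite mxE enum_rankK coefZ.
Qed.

(** Distinct orders of vanishing at [w] force linear independence: after division by the lowest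
    power that has a nonzero coefficient, exactly one term survives evaluation at [w]. *)
Lemma ord_independent (K : fieldType) (J : finType) (w : K) (e : J -> nat)
    (H : J -> {poly K}) (t : J -> K) :
  injective e -> (forall j, (H j).[w] != 0) ->
  \sum_j t j *: (('X - w%:P) ^+ e j * H j) = 0 -> forall j, t j = 0.
Proof.
move=> inj_e Hw sum0 j0; apply/eqP/negPn/negP => tj0.
case: (@arg_minnP _ j0 (fun j => t j != 0) e tj0) => j tj jmin.
have : ('X - w%:P) ^+ e j *
    (\sum_i t i *: (('X - w%:P) ^+ (e i - e j) * H i)) = 0.
  rewrite -[RHS]sum0 mulr_sumr; apply: eq_bigr => i _.
  have [->|ti] := eqVneq (t i) 0; first by rewrite !scale0r mulr0.
  by rewrite -scalerAr mulrA -exprD subnKC // jmin.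
move/eqP; rewrite mulf_eq0 expf_eq0 polyXsubC_eq0 andbF /= => /eqP.
move/(congr1 (horner_eval w)); rewrite /horner_eval horner0 horner_sum.
rewrite (bigD1 j) //= big1 => [|i ij].
  rewrite subnn expr0 mul1r hornerZ addr0 => /eqP.
  by rewrite mulf_eq0 (negPf tj) (negPf (Hw j)).
have [->|ti] := eqVneq (t i) 0; first by rewrite scale0r horner0.
have : (e i != e j) by apply: contraNneq ij => /inj_e ->.
have := jmin i ti => le_ji ne_ij; rewrite hornerZ hornerM horner_exp !hornerE.
by rewrite subrr expr0n subn_eq0 leqNgt ltn_neqAle eq_sym ne_ij le_ji /= mulr0 mul0r.
Qed.

Lemma expr_sum_pchar (K : comNzRingType) (p m : nat) (I : Type) (r : seq I)
    (P : pred I) (f : I -> K) : p \in [pchar K] ->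
  (\sum_(i <- r | P i) f i) ^+ (p ^ m) = \sum_(i <- r | P i) f i ^+ (p ^ m).
Proof.
move=> pK; have pp := pcharf_prime pK.
apply: (big_morph (fun x => x ^+ (p ^ m))) => [x y|].
  by rewrite exprDn_pchar // (eq_pnat _ (pcharf_eq pK)) pnatX pnat_id.
by rewrite expr0n expn_eq0 eqn0Ngt prime_gt0.
Qed.

Lemma exprB_pchar (K : comNzRingType) (p m : nat) (x y : K) :
  p \in [pchar K] -> (x - y) ^+ (p ^ m) = x ^+ (p ^ m) - y ^+ (p ^ m).
Proof.
move=> pK; have pp := pcharf_prime pK; apply/eqP; rewrite eq_sym subr_eq; apply/eqP.
rewrite -exprDn_pchar ?subrK // (eq_pnat _ (pcharf_eq pK)).
by rewrite pnatX pnat_id.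
Qed.

(** Degrees are bounded in the form [size <= d.+1], which is additive under products without a case
    distinction for the zero polynomial. *)
Lemma size_mul_deg (K : fieldType) (f g : {poly K}) (a b : nat) :
  (size f <= a.+1)%N -> (size g <= b.+1)%N -> (size (f * g)%R <= (a + b).+1)%N.
Proof. by move=> sf sg; apply: leq_trans (size_polyMleq _ _) _; lia. Qed.

Lemma size_exp_deg (K : fieldType) (f : {poly K}) (a n : nat) :
  (size f <= a.+1)%N -> (size (f ^+ n)%R <= (a * n).+1)%N.
Proof.
move=> sf; elim: n => [|n IH]; first by rewrite expr0 size_poly1 muln0.
by rewrite exprS mulnS; apply: size_mul_deg.
Qed.

Lemma size_roots_exp (K : fieldType) (Q : nat) (s : seq K) :
  (1 < Q)%N -> uniq s -> (forall x, x \in s -> x ^+ Q = x) -> (size s <= Q)%N.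
Proof.
move=> Q1 us xQ.
have sX : size ('X^Q - 'X : {poly K}) = Q.+1.
  by rewrite size_polyDl ?size_polyXn // size_polyN size_polyX ltnS.
have nz : ('X^Q - 'X : {poly K}) != 0 by rewrite -size_poly_eq0 sX.
rewrite -ltnS -sX; apply: max_poly_roots => //.
by apply/allP => x /xQ xE; rewrite rootE !hornerE xE subrr.
Qed.

Lemma closed_rootX (K : closedFieldType) (n : nat) (x : K) :
  (0 < n)%N -> exists y, y ^+ n == x.
Proof.
move=> n0; have [|y] := closed_rootP ('X^n - x%:P : {poly K}) _.
  rewrite size_polyDl ?size_polyXn; first by case: n n0.
  by rewrite size_polyN (leq_ltn_trans (size_polyC_leq1 _)).
by rewrite rootE !hornerE subr_eq0; exists y.
Qed.

Section Stepanov.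
Variables (K : closedFieldType) (p nu D : nat) (pK : p \in [pchar K]).
Variables (A B B' : {poly K}) (w c : K) (m : nat).
Hypotheses (sA : (size A <= D.+1)%N) (sB : (size B <= D.+1)%N).
Hypotheses (defB : B = ('X - w%:P) ^+ m * B') (B'w : B'.[w] != 0).
Hypotheses (Aw : A.[w] != 0) (cop : coprime m p).
Let P := (p ^ nu)%N.
Let M := (p ^ nu.+1)%N.
(** The numerator, over [B ^+ P], of the lower half of the trace of [A / B]: [nu.+1] of the
    [(nu.+1).*2] terms. Its top exponent [P] is only a [p]-th of [M], which is the gain in the final
    count. *)
Let W : {poly K} := \sum_(i < nu.+1) A ^+ (p ^ i) * B ^+ (P - p ^ i).
Let p_prime : prime p := pcharf_prime pK.

Let size_W : (size W <= (D * P).+1)%N.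
Proof.
apply: leq_trans (size_sum _ _ _) _; apply/bigmax_leqP => i _.
have le_iP : (p ^ i <= P)%N by rewrite leq_exp2l ?prime_gt1 // -ltnS.
rewrite -{2}(subnKC le_iP) mulnDr; apply: size_mul_deg; exact: size_exp_deg.
Qed.

Let m_gt0 : (0 < m)%N.
Proof.
case: m cop => // /eqP; rewrite gcd0n => p1; by move: p_prime; rewrite p1.
Qed.

(** Only the top term of [W] is free of the factor [B], which vanishes at [w]. *)
Let W_w : W.[w] != 0.
Proof.
rewrite horner_sum big_ord_recr /= big1 => [|i _].
  by rewrite add0r subnn expr0 mulr1 horner_exp expf_neq0.
have lt_iP : (p ^ i < P)%N by rewrite ltn_exp2l ?prime_gt1.
rewrite hornerM !horner_exp defB !hornerE subrr expr0n eqn0Ngt m_gt0 mul0r.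
by rewrite expr0n subn_eq0 leqNgt lt_iP mulr0.
Qed.

(* The auxiliary polynomial is T = sum of sigma_jli * G j l i. At a point x with
   x ^+ (M * M) = x and trace c, T ^+ M agrees, up to a power of B, with the same
   combination of the E j l i, because U := W / B ^+ P satisfies U ^+ M = c - U
   there; the E j l i are more numerous than their size, so the combination can
   be made to vanish identically. The G j l i have distinct orders at w since m
   is prime to p, so T itself is nonzero. *)
Let G (j l i : nat) : {poly K} :=
  ('X - w%:P) ^+ (l + M * i) * W ^+ j * B ^+ (P * (p.-1 - j)).
Let E (j l i : nat) : {poly K} :=
  ('X - w%:P) ^+ (l * M) * ('X - (w ^+ (M * M))%:P) ^+ i *
  (c *: B ^+ P - W) ^+ j * B ^+ (P * (p.-1 - j)).

Lemma stepanov_aux (s : seq K) : uniq s ->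
  (forall x, x \in s -> [/\ x ^+ (M * M) = x, B.[x] != 0 &
      \sum_(i < (nu.+1).*2) (A.[x] / B.[x]) ^+ (p ^ i) = c]) ->
  (D + 2 <= M)%N ->
  (size s <= P + M * (P + D + 1) + D * M)%N.
Proof.
move=> us xs leDM.
have P0 : (0 < P)%N by rewrite expn_gt0 prime_gt0.
have p0 := prime_gt0 p_prime.
have MP : M = (p * P)%N by rewrite /M expnS.
pose J := ('I_p * 'I_P * 'I_(P + D + 2))%type.
have cardJ : #|{: J}| = (M * (P + D + 2))%N by rewrite !card_prod !card_ord MP.
have lePM : (P <= M)%N by rewrite MP leq_pmull.
have jp (j : 'I_p) : (j + (p.-1 - j) = p.-1)%N by have := ltn_ord j; lia.
have sBW : (size (c *: B ^+ P - W)%R <= (D * P).+1)%N.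
  apply: leq_trans (size_polyD _ _) _; rewrite size_polyN geq_max size_W andbT.
  by apply: leq_trans (size_scale_leq _ _) (size_exp_deg _ _).
have bnd (j : 'I_p) : (D * P * j + D * (P * (p.-1 - j)) <= D * M)%N.
  by rewrite -mulnA -!mulnDr jp leq_mul2l MP mulnC leq_mul2r leq_pred !orbT.
have sXw (a : K) : (size ('X - a%:P)%R <= 2)%N by rewrite size_XsubC.
(* There are [M (P + D + 2)] unknowns against [(P - 1) M + (P + D + 1) + D M + 1] coefficients; the
   difference [3 M - (P + D + 2)] is positive because [D + 2 <= M] and [P <= M]. *)
have [t [j0 tj0] tE] : exists2 t : J -> K, (exists j, t j != 0) &
    \sum_j t j *: E j.1.1 j.1.2 j.2 = 0.
  apply: (@poly_dependent _ _ ((P.-1 * M + (P + D + 1) + D * M).+1)); last first.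
    by rewrite cardJ; nia.
  move=> [[j l] i] /=.
  apply: (@leq_trans (1 * (l * M) + 1 * i + D * P * j + D * (P * (p.-1 - j))).+1).
    apply: size_mul_deg; last exact: size_exp_deg.
    apply: size_mul_deg; last exact: size_exp_deg.
    by apply: size_mul_deg; apply: size_exp_deg; rewrite sXw.
  have := bnd j; have li := ltn_ord i.
  have : (l * M <= P.-1 * M)%N by rewrite leq_mul2r; have := ltn_ord l; lia.
  lia.
(* Raising [T] to the power [M] raises its coefficients too, so [T] is built from [M]-th roots of
   the [t j]. *)
have [sg sgE] : exists sg : {ffun J -> K}, forall j, sg j ^+ M = t j.
  have M0 : (0 < M)%N by rewrite expn_gt0 p0.
  exists [ffun j => xchoose (closed_rootX (t j) M0)] => j.
  by rewrite ffunE; exact/eqP/(xchooseP (closed_rootX (t j) M0)).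
pose T := \sum_j sg j *: G j.1.1 j.1.2 j.2.
have T0 : T != 0.
  apply: contra_neq tj0 => T0; rewrite -sgE; apply/eqP; rewrite expf_eq0.
  suff -> : sg j0 = 0 by rewrite eqxx expn_gt0 p0.
  move: j0; apply: (@ord_independent _ _ w
    (fun j : J => j.1.2 + M * j.2 + m * (P * (p.-1 - j.1.1)))%N
    (fun j : J => W ^+ j.1.1 * B' ^+ (P * (p.-1 - j.1.1)))).
  (* The order at [w] is [l + M i + m P (p - 1 - j)]. Its residue mod [P] recovers [l]; the quotient
     by [P], taken mod [p], recovers [j] because [m] is prime to [p]; then [i] follows. *)
  - move=> [[j l] i] [[j' l'] i'] /= eqe.
    have lt_l := ltn_ord l; have lt_l' := ltn_ord l'.
    have eE a x y : (a + M * x + m * (P * y) = (p * x + m * y) * P + a)%N.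
      by rewrite MP; ring.
    move: eqe; rewrite !eE => eqe.
    have eql : (l = l' :> nat)%N.
      by have := congr1 (modn^~ P) eqe; rewrite /= !modnMDl !modn_small.
    have eqij : (p * i + m * (p.-1 - j) = p * i' + m * (p.-1 - j'))%N.
      by apply/eqP; rewrite -(eqn_pmul2r P0); apply/eqP; move: eqe; rewrite eql; lia.
    have eqj : (j = j' :> nat)%N.
      have lj := ltn_ord j; have lj' := ltn_ord j'.
      have := congr1 (modn^~ p) eqij; rewrite ![(p * _)%N]mulnC !modnMDl.
      move/eqP; have [le|le] := leqP (p.-1 - j) (p.-1 - j').
        rewrite eq_sym eqn_mod_dvd ?leq_mul2l ?le ?orbT // -mulnBr.
        rewrite Gauss_dvdr 1?coprime_sym // => /dvdn_leq; lia.
      rewrite eqn_mod_dvd ?leq_mul2l ?(ltnW le) ?orbT // -mulnBr.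
      rewrite Gauss_dvdr 1?coprime_sym // => /dvdn_leq; lia.
    have eqi : (i = i' :> nat)%N by move: eqij; rewrite eqj; nia.
    by congr (_, _, _); apply: val_inj.
  - by move=> j; rewrite hornerM !horner_exp mulf_neq0 // expf_neq0.
  rewrite -[RHS]T0; apply: eq_bigr => j _; congr (_ *: _).
  by rewrite /G defB exprMn -exprM exprD; ring.
have Tx x : x \in s -> root T x.
  move=> /xs[xQ Bx tr]; rewrite rootE.
  pose U := \sum_(i < nu.+1) (A.[x] / B.[x]) ^+ (p ^ i).
  (* The upper half of the trace is the [M]-th power of the lower half [U]. *)
  have UM : U ^+ M = c - U.
    rewrite -tr -addnn big_split_ord /= -/U [U + _]addrC addrK expr_sum_pchar //.
    by apply: eq_bigr => i _; rewrite -exprM -expnD addnC.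
  have Wx : W.[x] = B.[x] ^+ P * U.
    rewrite horner_sum mulr_sumr; apply: eq_bigr => i _.
    have le_iP : (p ^ i <= P)%N by rewrite leq_exp2l ?prime_gt1 // -ltnS.
    rewrite hornerM !horner_exp -{2}(subnKC le_iP) exprD exprMn exprVn.
    by field; rewrite expf_neq0.
  have xwM i : (x - w) ^+ (M * i * M) = (x - w ^+ (M * M)) ^+ i.
    by rewrite mulnAC exprM /M -expnD exprB_pchar // expnD xQ.
  have : B.[x] ^+ (P * p.-1 * M) * (\sum_j t j *: E j.1.1 j.1.2 j.2).[x] = 0.
    by rewrite tE horner0 mulr0.
  have : T.[x] ^+ M * B.[x] ^+ (P * p.-1) =
     B.[x] ^+ (P * p.-1 * M) * (\sum_j t j *: E j.1.1 j.1.2 j.2).[x].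
    rewrite !horner_sum expr_sum_pchar // mulr_suml mulr_sumr; apply: eq_bigr => j _.
    rewrite !hornerZ exprMn sgE -mulrA [RHS]mulrCA; congr (_ * _).
    rewrite !hornerM !horner_exp !hornerE Wx.
    rewrite (_ : c * _ - _ = B.[x] ^+ P * (c - U)); last by ring.
    rewrite !exprMn -!exprM mulnDl exprD xwM [(j.1.1 * M)%N]mulnC (exprM U) UM.
    have Bj : B.[x] ^+ (P * p.-1) = B.[x] ^+ (P * j.1.1) * B.[x] ^+ (P * (p.-1 - j.1.1)).
      by rewrite -exprD -mulnDr jp.
    rewrite [B.[x] ^+ (P * p.-1 * M)]exprM Bj exprMn -!exprM -/M.
    by rewrite /= mulnA [(P * M * _)%N]mulnAC; ring.
  move=> /[swap] -> /eqP; rewrite mulf_eq0 !expf_eq0 (negPf Bx) !andbF orbF.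
  by case/andP.
rewrite -ltnS; apply: leq_trans (max_poly_roots T0 _ us) _; first exact/allP.
apply: leq_trans (size_sum _ _ _) _; apply/bigmax_leqP => -[[j l] i] _ /=.
apply: leq_trans (size_scale_leq _ _) _.
apply: (@leq_trans (1 * (l + M * i) + D * P * j + D * (P * (p.-1 - j))).+1).
  apply: size_mul_deg; last exact: size_exp_deg.
  by apply: size_mul_deg; apply: size_exp_deg; rewrite ?sXw.
have : (M * i <= M * (P + D + 1))%N by rewrite leq_mul2l; have := ltn_ord i; lia.
have := bnd j; have := ltn_ord l; lia.
Qed.

(** The leading term [M * M / p] is exactly the share expected for one of the [p] possible
    traces. *)
Lemma stepanov (s : seq K) : uniq s ->
  (forall x, x \in s -> [/\ x ^+ (M * M) = x, B.[x] != 0 &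
      \sum_(i < (nu.+1).*2) (A.[x] / B.[x]) ^+ (p ^ i) = c]) ->
  (p * size s <= M * M + (p * (2 * D + 2) + 1) * M)%N.
Proof.
move=> us xs; have p0 := prime_gt0 p_prime.
have MP : M = (p * P)%N by rewrite /M expnS.
(* If [M < D + 2], the trivial count [size s <= M * M] is already below the bound. *)
have [leDM|ltMD] := leqP (D + 2) M.
  apply: leq_trans (leq_mul (leqnn p) (stepanov_aux us xs leDM)) _.
  have -> : (p * (P + M * (P + D + 1) + D * M) =
             M * M + (p * (2 * D + 1) + 1) * M)%N by rewrite MP; ring.
  by rewrite leq_add2l leq_mul2r leq_add2r leq_mul2l; lia.
have M1 : (1 < M * M)%N.
  have := ltn_expl nu.+1 (prime_gt1 p_prime); rewrite -/M => ltM.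
  by rewrite -[1%N](muln1 1) ltn_mul // (leq_ltn_trans _ ltM).
have := size_roots_exp M1 us (fun x xin => let: And3 e _ _ := xs x xin in e).
move=> le; apply: leq_trans (leq_mul (leqnn p) le) _.
have : (p * (M * M) <= p * (2 * D + 2) * M)%N.
  by rewrite -mulnA leq_mul2l leq_mul2r; lia.
by rewrite mulnDl; lia.
Qed.
End Stepanov.

(** * The L-function attached to a multiplicative function *)

Section ClosureOfFiniteField.
Variables (F : finFieldType) (K : closedFieldType) (iota : {rmorphism F -> K}).
Variables (p k : nat).
Hypotheses (pK : p \in [pchar K]) (k_gt0 : (0 < k)%N) (cardF : #|F| = (p ^ k)%N).
Local Notation q := (p ^ k)%N.

Let p_prime : prime p := pcharf_prime pK.

Let q_gt1 : (1 < q)%N.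
Proof. by rewrite -(exp1n k) ltn_exp2r // prime_gt1. Qed.

Definition frob_q (x : K) : K := x ^+ q.

Let frob_q_is_nmod_morphism : nmod_morphism frob_q.
Proof.
split=> [|x y]; first by rewrite /frob_q expr0n eqn0Ngt (ltnW q_gt1).
by rewrite /frob_q exprDn_pchar // (eq_pnat _ (pcharf_eq pK)) pnatX pnat_id.
Qed.

Let frob_q_is_monoid_morphism : monoid_morphism frob_q.
Proof. by split=> [|x y]; rewrite /frob_q ?expr1n ?exprMn. Qed.

HB.instance Definition _ := GRing.isNmodMorphism.Build K K frob_q
  frob_q_is_nmod_morphism.
HB.instance Definition _ := GRing.isMonoidMorphism.Build K K frob_q
  frob_q_is_monoid_morphism.

Lemma frob_q_inj : injective frob_q. Proof. exact: fmorph_inj. Qed.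

Lemma iota_frob a : iota a ^+ q = iota a.
Proof. by rewrite -rmorphXn -cardF expf_card. Qed.

Lemma fixed_iota (y : K) : y ^+ q = y -> exists a, iota a == y.
Proof.
move=> yq; have := congr1 (map_poly iota) (finField_genPoly F).
move/(congr1 (horner_eval y)); rewrite /horner_eval rmorphB /= map_polyXn map_polyX.
rewrite !hornerE cardF yq subrr rmorph_prod horner_prod => /esym/eqP.
rewrite prodf_seq_eq0 => /hasP[a _]; rewrite /= rmorphB /= map_polyX map_polyC /=.
by rewrite !hornerE subr_eq0 eq_sym => ay; exists a.
Qed.

Definition descend (P : {poly K}) : {poly F} :=
  \poly_(i < size P) odflt 0 [pick a | iota a == P`_i].

Lemma descendK (P : {poly K}) :
  map_poly frob_q P = P -> map_poly iota (descend P) = P.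
Proof.
move=> fP; apply/polyP=> i; rewrite coef_map coef_poly.
case: ifP => [_|/negbT]; last by rewrite -leqNgt => le; rewrite (nth_default 0 le) raddf0.
case: pickP => [a /eqP //|noa]; have [|a] := @fixed_iota P`_i; last by rewrite noa.
by rewrite -[in RHS]fP coef_map.
Qed.

Lemma map_iota_frob (g : {poly F}) :
  map_poly frob_q (map_poly iota g) = map_poly iota g.
Proof. by apply/polyP=> i; rewrite !coef_map; apply: iota_frob. Qed.

Lemma root_frob (g : {poly F}) (x : K) :
  root (map_poly iota g) x -> root (map_poly iota g) (x ^+ q).
Proof.
move=> /rootP gx; apply/rootP; rewrite -map_iota_frob -[x ^+ q]/(frob_q x).
by rewrite horner_map gx rmorph0.
Qed.

Lemma expq_iter (x : K) i : x ^+ (q ^ i) = iter i frob_q x.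
Proof.
elim: i => [|i IH]; first by rewrite expn0 expr1.
by rewrite expnS mulnC exprM IH.
Qed.

(* When x ^+ (q ^ n) = x this is a power of the minimal polynomial of x. *)
Definition normK (n : nat) (x : K) : {poly K} :=
  \prod_(i < n) ('X - (x ^+ (q ^ i))%:P).

Definition norm_poly (n : nat) (x : K) : {poly F} := descend (normK n x).

Let map_frob_XsubC (a : K) : map_poly frob_q ('X - a%:P) = 'X - (a ^+ q)%:P.
Proof. by rewrite rmorphB /= map_polyX map_polyC. Qed.

Lemma norm_polyE n x : x ^+ (q ^ n) = x -> map_poly iota (norm_poly n x) = normK n x.
Proof.
move=> xn; apply: descendK; rewrite rmorph_prod /=.
case: n xn => [|n] xn; first by rewrite /normK !big_ord0.
rewrite /normK big_ord_recr big_ord_recl mulrC; congr (_ * _); last first.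
  rewrite map_frob_XsubC -exprM -expnSr.
  by rewrite [x ^+ _]xn expn0 expr1.
apply: eq_bigr => i _; rewrite map_frob_XsubC.
by rewrite -exprM -expnSr.
Qed.

Lemma size_normK n x : size (normK n x) = n.+1.
Proof. by rewrite size_prod_XsubC /index_enum -enumT size_enum_ord. Qed.

Lemma normK_monic n x : normK n x \is monic.
Proof. exact: monic_prod_XsubC. Qed.

Lemma norm_poly_monic n x : x ^+ (q ^ n) = x -> norm_poly n x \is monic.
Proof. by move=> /norm_polyE e; rewrite -(map_monic iota) e normK_monic. Qed.

Lemma size_norm_poly n x : x ^+ (q ^ n) = x -> size (norm_poly n x) = n.+1.
Proof. by move=> /norm_polyE e; rewrite -(size_map_poly iota) e size_normK. Qed.

Lemma normK_root n x : root (normK n.+1 x) x.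
Proof.
by rewrite /root /normK big_ord_recl expn0 expr1 hornerM !hornerE subrr mul0r.
Qed.

Lemma normKD m n x : x ^+ (q ^ m) = x -> normK (m + n) x = normK m x * normK n x.
Proof.
move=> xm; rewrite /normK big_split_ord /=; congr (_ * _).
by apply: eq_bigr => i _; rewrite expnD exprM xm.
Qed.

Lemma expq_addl m n (x : K) :
  x ^+ (q ^ m) = x -> (x ^+ (q ^ (m + n)) == x) = (x ^+ (q ^ n) == x).
Proof. by move=> xm; rewrite expnD exprM xm. Qed.

Lemma expq_cancel i j (x : K) :
  (i <= j)%N -> x ^+ (q ^ i) = x ^+ (q ^ j) -> x ^+ (q ^ (j - i)) = x.
Proof.
move=> le_ij; rewrite -{1}(subnK le_ij) expnD exprM !(expq_iter _ i) => e.
apply/esym; have iter_inj : injective (iter i frob_q).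
  by elim: (i) => [|m IH] a b //= /frob_q_inj /IH.
exact: iter_inj e.
Qed.

(** Pigeonhole: [n.+1] successive conjugates of [x] are roots of [g], so two coincide, and
    injectivity of Frobenius cancels the common iterate. *)
Lemma frob_period (n : nat) (g : {poly F}) (x : K) :
  g != 0 -> (size g <= n.+1)%N -> root (map_poly iota g) x ->
  exists2 d, (0 < d <= n)%N & x ^+ (q ^ d) = x.
Proof.
move=> g0 sg gx; pose rs := [seq x ^+ (q ^ i) | i <- seq.iota 0 n.+1].
have grs : all (root (map_poly iota g)) rs.
  apply/allP=> _ /mapP[i _ ->]; elim: i => [|i IH]; first by rewrite expn0 expr1.
  by rewrite expnSr exprM root_frob.
have : ~~ uniq rs.
  apply/negP=> urs; have := max_poly_roots _ grs urs.
  rewrite map_poly_eq0 size_map_poly size_map size_iota => /(_ g0).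
  by rewrite ltnNge sg.
case/(uniqPn 0) => i [j []]; rewrite size_map size_iota => lt_ij lt_j.
rewrite !(nth_map 0%N) ?size_iota ?(ltn_trans lt_ij) // !nth_iota // ?(ltn_trans lt_ij) //.
rewrite !add0n => e; exists (j - i)%N; first by lia.
exact: expq_cancel (ltnW lt_ij) e.
Qed.

(* If d is the least period of x, then normK (d * e) x is the e-th power of the
   minimal polynomial of x, which divides g exactly for e up to the multiplicity
   of x in g. *)
Lemma count_norm_dvd (n : nat) (g : {poly F}) (x : K) :
  g \is monic -> (size g <= n.+1)%N ->
  (\sum_(j < n) ((x ^+ (q ^ j.+1) == x)
     && (normK j.+1 x %| map_poly iota g)%R))%N = mup x (map_poly iota g).
Proof.
elim/ltn_ind: n g => n IH g gm sg; have g0 := monic_neq0 gm.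
have [gx|gx] := boolP (root (map_poly iota g) x); last first.
  rewrite mupNroot // big1 // => j _; case: eqP => //= _.
  apply/eqP; rewrite eqb0; apply: contra gx => /dvdpP[h ->].
  by rewrite rootM normK_root orbT.
have [d0 /andP[d0_gt0 d0_n] d0x] := frob_period g0 sg gx.
have exd : exists d, (0 < d)%N && (x ^+ (q ^ d) == x).
  by exists d0; rewrite d0_gt0 d0x eqxx.
case: (ex_minnP exd) => -[|d] //= /eqP dx dmin.
have ltdn : (d < n)%N.
  by apply: leq_trans d0_n; apply: dmin; rewrite d0_gt0 d0x eqxx.
pose rs := [seq x ^+ (q ^ i) | i <- seq.iota 0 d.+1].
have nrs : normK d.+1 x = \prod_(z <- rs) ('X - z%:P).
  have -> : rs = [seq x ^+ (q ^ i) | i <- index_iota 0 d.+1].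
    by rewrite /index_iota subn0.
  by rewrite big_map big_mkord.
have urs : uniq rs.
  apply: contraT => /(uniqPn 0) [i [j []]]; rewrite size_map size_iota => lt_ij lt_j.
  rewrite !(nth_map 0%N) ?size_iota ?(ltn_trans lt_ij) //.
  rewrite !nth_iota // ?(ltn_trans lt_ij) // !add0n => e.
  have := dmin (j - i)%N; rewrite (expq_cancel (ltnW lt_ij) e) eqxx andbT subn_gt0.
  by move=> /(_ lt_ij); lia.
have dvg : normK d.+1 x %| map_poly iota g.
  rewrite nrs; have [||h ->] := @uniq_roots_prod_XsubC _ (map_poly iota g) rs.
  - apply/allP=> _ /mapP[i _ ->]; elim: i => [|i IHi]; first by rewrite expn0 expr1.
    by rewrite expnSr exprM root_frob.
  - by rewrite uniq_rootsE.
  - exact: dvdp_mull.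
have /dvdpP[g1 defg] : norm_poly d.+1 x %| g.
  by rewrite -(dvdp_map iota) norm_polyE.
have g1m : g1 \is monic.
  by move: gm; rewrite defg monicMr // norm_poly_monic.
have sg1 : size g = (size g1 + d.+1)%N.
  by rewrite defg size_monicM ?monic_neq0 ?norm_poly_monic // size_norm_poly // addnS.
have gE : map_poly iota g = normK d.+1 x * map_poly iota g1.
  by rewrite defg rmorphM /= norm_polyE // mulrC.
rewrite gE mupM ?monic_neq0 ?normK_monic ?map_monic //.
have -> : mup x (normK d.+1 x) = 1%N.
  rewrite nrs mu_prod_XsubC count_uniq_mem //.
  suff -> : x \in rs by [].
  by apply/mapP; exists 0%N; rewrite ?mem_iota // expn0 expr1.
have [m nE] : exists m, n = (d.+1 + m)%N by exists (n - d.+1)%N; lia.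
rewrite nE big_split_ord /= big_ord_recr /= dx eqxx dvdp_mulr ?dvdpp //.
rewrite big1 ?add0n => [|j _]; last first.
  apply/eqP; rewrite eqb0; apply/negP=> /andP[jx _].
  by have := dmin j.+1; rewrite jx /= ltnS leqNgt ltn_ord => /(_ isT).
have sm : (size g1 <= m.+1)%N by move: sg; rewrite sg1; lia.
have lt_mn : (m < n)%N by lia.
congr (_ + _)%N; rewrite -(IH m) //.
apply: eq_bigr => j _; rewrite -addnS expq_addl // normKD // dvdp_mul2l //.
by rewrite monic_neq0 ?normK_monic.
Qed.

(** The extension of degree [n], listed as roots. For [n = 0] the polynomial is zero and the list
    carries no information, whence the shift to [n.+1] below. *)
Definition fixed (n : nat) : seq K :=
  sval (closed_field_poly_normal ('X^(q ^ n) - 'X)).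

Let expq_gt1 n : (1 < q ^ n.+1)%N.
Proof. by rewrite -(exp1n n.+1) ltn_exp2r. Qed.

Let size_fixpoly n : size ('X^(q ^ n.+1) - 'X : {poly K}) = (q ^ n.+1).+1.
Proof. by rewrite size_polyDl ?size_polyXn // size_polyN size_polyX ltnS. Qed.

Lemma fixedE n : 'X^(q ^ n.+1) - 'X = \prod_(z <- fixed n.+1) ('X - z%:P) :> {poly K}.
Proof.
rewrite /fixed; case: closed_field_poly_normal => r /= {1}->.
by rewrite lead_coefDl ?lead_coefXn ?scale1r // size_polyN size_polyX size_polyXn ltnS.
Qed.

Lemma mem_fixed n x : (x \in fixed n.+1) = (x ^+ (q ^ n.+1) == x).
Proof. by rewrite -root_prod_XsubC -fixedE rootE !hornerE subr_eq0. Qed.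

Lemma fixed_uniq n : uniq (fixed n.+1).
Proof.
rewrite -separable_prod_XsubC -fixedE separable_poly.unlock.
apply/Bezout_eq1_coprimepP; exists (0, -1) => /=.
rewrite mul0r add0r derivB derivXn derivX -scaler_nat.
have -> : (q ^ n.+1)%:R = 0 :> K.
  by rewrite !natrX (pcharf0 pK) expr0n eqn0Ngt k_gt0 expr0n.
by rewrite scale0r sub0r mulrNN mulr1.
Qed.

Lemma size_fixed n : size (fixed n.+1) = (q ^ n.+1)%N.
Proof.
apply/eqP; rewrite -eqSS -(size_prod_XsubC (fixed n.+1) id) -fixedE.
by rewrite size_fixpoly.
Qed.

Lemma sum_nat_count (T : Type) (a : pred T) (s : seq T) :
  (\sum_(x <- s) a x)%N = count a s.
Proof. by rewrite -sumn_count sumnE big_map. Qed.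

Lemma root_mu_sum (r : seq K) :
  (\sum_(x <- undup r) mup x (\prod_(z <- r) ('X - z%:P))%R)%N = size r.
Proof.
rewrite -sum1_size -[RHS](big_undup_iterop_count _ r xpredT (fun=> 1%N)).
apply: eq_bigr => x _.
by rewrite mu_prod_XsubC Monoid.iteropE iter_addn mul1n addn0.
Qed.

(** The polynomial analogue of the sum of the von Mangoldt function over the divisors being the
    logarithm: a power [f ^+ e] of an irreducible [f] of degree [d] is the norm polynomial of
    exactly [d] elements at [j.+1 = d * e]. The count is made root by root, the multiplicities
    adding up to the degree. *)
Lemma norm_dvd_total (n : nat) (g : {poly F}) :
  g \is monic -> size g = n.+1 ->
  (\sum_(j < n) \sum_(x <- fixed j.+1) (norm_poly j.+1 x %| g)%R)%N = n.
Proof.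
move=> gm sg; have [r] := closed_field_poly_normal (map_poly iota g).
rewrite (monicP _) ?map_monic // scale1r => gr.
have sr : size r = n.
  by apply/eqP; rewrite -eqSS -sg -(size_map_poly iota) gr size_prod_XsubC.
rewrite -[RHS]sr -root_mu_sum -gr.
under [RHS]eq_bigr => x _ do rewrite -(count_norm_dvd _ gm (eq_leq sg)).
rewrite [RHS]exchange_big; apply: eq_bigr => j _ /=.
rewrite !sum_nat_count -!size_filter; apply/perm_size/uniq_perm.
- by rewrite filter_uniq // fixed_uniq.
- by rewrite filter_uniq // undup_uniq.
move=> x; rewrite !mem_filter mem_fixed mem_undup andbC; case: eqP => //= xj.
rewrite -(dvdp_map iota) norm_polyE //; case: (boolP (_ %| _)) => //= dv.
by rewrite -root_prod_XsubC -gr; have /dvdpP[h ->] := dv; rewrite rootM normK_root orbT.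
Qed.

(** Encoding a monic polynomial of degree [n] by its lower coefficients gives a finite type to sum
    over. *)
Definition monic_of_row (n : nat) (c : 'rV[F]_n) : {poly F} := 'X^n + rVpoly c.

Lemma monic_of_row_monic n (c : 'rV[F]_n) : monic_of_row c \is monic.
Proof.
by rewrite monicE /monic_of_row lead_coefDl ?lead_coefXn // size_polyXn ltnS size_poly.
Qed.

Lemma size_monic_of_row n (c : 'rV[F]_n) : size (monic_of_row c) = n.+1.
Proof. by rewrite /monic_of_row size_polyDl ?size_polyXn // ltnS size_poly. Qed.

Definition row_of_monic (n : nat) (g : {poly F}) : 'rV[F]_n := poly_rV (g - 'X^n).

Lemma row_of_monicK n (g : {poly F}) :
  g \is monic -> size g = n.+1 -> monic_of_row (row_of_monic n g) = g.
Proof.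
move=> gm sg; rewrite /monic_of_row /row_of_monic poly_rV_K; first by rewrite addrC subrK.
apply/leq_sizeP => j; rewrite leq_eqVlt coefB coefXn => /orP[/eqP <-|lt_nj].
  by rewrite eqxx; move: gm; rewrite monicE /lead_coef sg => /eqP ->; rewrite subrr.
by rewrite nth_default ?sg // gtn_eqF // subr0.
Qed.

Lemma monic_of_rowK n : cancel (@monic_of_row n) (row_of_monic n).
Proof. by move=> c; rewrite /row_of_monic /monic_of_row addrC addKr rVpolyK. Qed.

(* Lcoef n is the coefficient of degree n of the L-function of Psi, and Lsum n
   is the associated sum over the field with q ^ n elements. *)
Section Newton.
Variables (C : comNzRingType) (Psi : {poly F} -> C).
Hypothesis PsiM : {in monic &, {morph Psi : g h / g * h}}.

Definition Lcoef (n : nat) : C := \sum_(c : 'rV[F]_n) Psi (monic_of_row c).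
Definition Lsum (n : nat) : C := \sum_(x <- fixed n) Psi (norm_poly n x).

(** Multiplication by the norm polynomial is a bijection from the monic polynomials of degree [n] to
    its monic multiples of degree [j + n], with [down] as inverse of [up]. *)
Lemma Lcoef_norm n j x : x ^+ (q ^ j) = x ->
  Psi (norm_poly j x) * Lcoef n =
  \sum_(c : 'rV[F]_(j + n)) Psi (monic_of_row c) *+ (norm_poly j x %| monic_of_row c)%R.
Proof.
move=> xj; have Nm := norm_poly_monic xj; have sN := size_norm_poly xj.
pose up (c : 'rV[F]_n) := row_of_monic (j + n) (norm_poly j x * monic_of_row c).
pose down (c : 'rV[F]_(j + n)) := row_of_monic n (monic_of_row c %/ norm_poly j x).
have upE c : monic_of_row (up c) = norm_poly j x * monic_of_row c.
  rewrite row_of_monicK ?monicMl ?monic_of_row_monic //.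
  by rewrite size_Mmonic ?monic_neq0 ?monic_of_row_monic // sN size_monic_of_row addnS.
rewrite (eq_bigr (fun c => if norm_poly j x %| monic_of_row c
    then Psi (monic_of_row c) else 0)); last by move=> c _; case: ifP.
rewrite -big_mkcond (reindex_onto up down) /= => [|c dv]; last first.
  apply: (can_inj (@monic_of_rowK _)); rewrite upE mulrC.
  have cE := divpK dv; rewrite row_of_monicK //.
    by rewrite -(monicMr _ Nm) cE monic_of_row_monic.
  by rewrite size_divp ?monic_neq0 // size_monic_of_row sN /=; lia.
rewrite mulr_sumr; apply: eq_big => [c|c _].
  rewrite upE dvdp_mulr ?dvdpp // /down upE mulrC mulpK ?monic_neq0 //.
  by rewrite monic_of_rowK eqxx.
by rewrite upE PsiM ?monic_of_row_monic.
Qed.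

(** The coefficient form of [X L' = L * (sum of Lsum j X^j)]: on the left each monic [g] is weighted
    by its degree, which [norm_dvd_total] resolves into pairs of an extension and a point. *)
Lemma newton_Lcoef n :
  n%:R * Lcoef n = \sum_(j < n) Lsum j.+1 * Lcoef (n - j.+1).
Proof.
have -> : \sum_(j < n) Lsum j.+1 * Lcoef (n - j.+1) =
  \sum_(j < n) \sum_(c : 'rV[F]_n) \sum_(x <- fixed j.+1)
     Psi (monic_of_row c) *+ (norm_poly j.+1 x %| monic_of_row c)%R.
  apply: eq_bigr => j _; rewrite exchange_big /Lsum mulr_suml !big_seq.
  apply: eq_bigr => x; rewrite mem_fixed => /eqP xj.
  have := Lcoef_norm (n - j.+1) xj; by rewrite subnKC.
rewrite exchange_big mulr_sumr; apply: eq_bigr => c _ /=.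
rewrite -[n in n%:R](norm_dvd_total (monic_of_row_monic c) (size_monic_of_row c)).
rewrite natr_sum mulr_suml; apply: eq_bigr => j _.
by rewrite natr_sum mulr_suml; apply: eq_bigr => x _; rewrite mulr_natl.
Qed.

End Newton.
End ClosureOfFiniteField.

(** * Newton's identities and the size of reciprocal roots *)

(** Newton's identities, the signs being absorbed in the coefficients of the product of the
    [1 - w X]. Induction on the roots: the contribution of a new root telescopes ([tele]), since
    [w X / (1 - w X)] times [(1 - w X) f] is [w X f]. *)
Lemma newton_power_sums (C : comNzRingType) (ws : seq C) (n : nat) :
  let e i := (\prod_(w <- ws) (1 - w *: 'X))`_i in
  n%:R * e n + \sum_(j < n) (\sum_(w <- ws) w ^+ j.+1) * e (n - j.+1)%N = 0.
Proof.
elim: ws n => [|w ws IH] n /=.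
  rewrite big_nil coef1 big1 => [|j _]; last by rewrite big_nil mul0r.
  by case: n => [|n]; rewrite ?mul0r ?mulr0 addr0.
set f := \prod_(w <- ws) _ in IH *; rewrite big_cons -/f.
have eE i : ((1 - w *: 'X) * f)`_i = f`_i - (if i is i'.+1 then w * f`_i' else 0).
  rewrite mulrBl mul1r coefB; congr (_ - _).
  by rewrite -scalerAl coefZ coefXM; case: i => [|i]; rewrite //= mulr0.
have tele m : \sum_(j < m) w ^+ j.+1 * ((1 - w *: 'X) * f)`_(m - j.+1) =
    (if m is m'.+1 then w * f`_m' else 0).
  elim: m => [|m IHm]; first by rewrite big_ord0.
  rewrite big_ord_recl /= subSS subn0 expr1 eE.
  under eq_bigr => j _ do rewrite exprS -mulrA subSS.
  by rewrite -mulr_sumr IHm; case: (m) => [|m']; rewrite ?mulr0 ?addr0 ?subr0 ?mulrBr ?subrK.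
under eq_bigr => j _ do rewrite big_cons mulrDl.
rewrite big_split /= tele; case: n => [|n].
  by rewrite mul0r big_ord0 !addr0.
under eq_bigr => j _ do rewrite eE mulrBr.
rewrite sumrB.
have := IH n.+1 => /eqP; rewrite addr_eq0 => /eqP e1.
have := IH n => /eqP; rewrite addr_eq0 => /eqP e2.
have -> : \sum_(j < n.+1) (\sum_(x <- ws) x ^+ j.+1) * f`_(n.+1 - j.+1) =
   - (n.+1%:R * f`_n.+1) by rewrite e1 opprK.
have -> : \sum_(j < n.+1) (\sum_(x <- ws) x ^+ j.+1) *
     (if (n.+1 - j.+1)%N is i'.+1 then w * f`_i' else 0) = - (w * (n%:R * f`_n)).
  rewrite e2 mulrN opprK big_ord_recr /= subnn mulr0 addr0 mulr_sumr.
  apply: eq_bigr => j _ /=; rewrite subSS -(subnSK (ltn_ord j)).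
  by rewrite mulrCA.
by rewrite eE [in X in X * _ + _]mulrS; ring.
Qed.

Lemma reciprocal_roots (C : closedFieldType) (a : nat -> C) (D : nat) :
  a 0%N = 1 -> (forall n, (D < n)%N -> a n = 0) ->
  exists2 ws : seq C, (size ws <= D)%N &
    forall n, a n = (\prod_(w <- ws) (1 - w *: 'X))`_n.
Proof.
move=> a0 aD; pose P := \poly_(i < D.+1) a i.
have Pa n : P`_n = a n by rewrite coef_poly ltnS; case: leqP => // /aD.
have [r Pr] := closed_field_poly_normal P.
have P00 : P.[0] = 1 by rewrite horner_coef0 Pa.
have P0 : P != 0 by apply: contra_eq_neq P00 => ->; rewrite horner0 eq_sym oner_neq0.
have r0 z : z \in r -> z != 0.
  rewrite -root_prod_XsubC; apply: contraTneq => ->; apply/negP=> /rootP r00.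
  by move: P00; rewrite Pr hornerZ r00 mulr0 => /eqP; rewrite eq_sym oner_eq0.
exists [seq z^-1 | z <- r].
  have lP : lead_coef P != 0 by rewrite lead_coef_eq0.
  by rewrite size_map -ltnS -(size_prod_XsubC r id) -(size_scale _ lP) -Pr size_poly.
have prE : \prod_(w <- [seq z^-1 | z <- r]) (1 - w *: 'X) =
    (\prod_(z <- r) (- z^-1)) *: \prod_(z <- r) ('X - z%:P).
  rewrite big_map; elim: (r) r0 => [|z s IH] r0; first by rewrite !big_nil scale1r.
  have z0 : z != 0 by rewrite r0 ?mem_head.
  rewrite !big_cons IH => [|y ys]; last by apply: r0; rewrite inE ys orbT.
  have -> : 1 - z^-1 *: 'X = (- z^-1) *: ('X - z%:P).
    by rewrite scalerBr scaleNr -(mul_polyC _ z%:P) -polyCM mulNr mulVf // polyCN opprK addrC.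
  by rewrite -scalerAl -scalerAr scalerA.
have prP : \prod_(w <- [seq z^-1 | z <- r]) (1 - w *: 'X) = P.
  have lP : lead_coef P != 0 by rewrite lead_coef_eq0.
  set c := \prod_(z <- r) - z^-1 in prE.
  set R := \prod_(w <- _) _ in prE *.
  have PE : P = (lead_coef P / c) *: R.
    rewrite prE scalerA divfK // prodf_seq_neq0; apply/allP => z /r0 z0.
    by rewrite oppr_eq0 invr_eq0.
  have R0 : R.[0] = 1 by rewrite horner_prod big1_seq // => w _; rewrite !hornerE; ring.
  by move: P00; rewrite PE hornerZ R0 mulr1 => k1; rewrite k1 scale1r.
by move=> n; rewrite prP Pa.
Qed.

(** As [a 0 = 1], Newton's relations determine [S] recursively from [a], and the negated power sums
    satisfy the same relations. *)
Lemma power_sums_unique (C : comNzRingType) (a S : nat -> C) (ws : seq C) :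
  a 0%N = 1 -> (forall n, a n = (\prod_(w <- ws) (1 - w *: 'X))`_n) ->
  (forall n, n%:R * a n = \sum_(j < n) S j.+1 * a (n - j.+1)%N) ->
  forall n, S n.+1 = - \sum_(w <- ws) w ^+ n.+1.
Proof.
move=> a0 aE aS n; elim/ltn_ind: n => n IH.
have := newton_power_sums ws n.+1; rewrite /= -!aE aS.
under [in X in _ + X]eq_bigr => j _ do rewrite -aE.
rewrite !big_ord_recr /= subnn a0 !mulr1 => /eqP; rewrite addrACA.
rewrite -big_split big1 => [|j _]; first by rewrite add0r addr_eq0 => /eqP.
by rewrite /= IH // mulNr addNr.
Qed.

Section ArchimedeanBounds.
Variable C : numClosedFieldType.
Hypothesis archiC : forall x : C, exists n : nat, `|x| <= n%:R.

(** Bernoulli's inequality: if [|b| > 1], the powers outgrow every natural number, and by [archiC]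
    also [c]. *)
Lemma bounded_powers (b c : C) : (forall n, `|b| ^+ n <= c) -> `|b| <= 1.
Proof.
move=> bc; rewrite real_leNgt ?real1 ?normr_real //; apply/negP => b1.
have bern n : n%:R * (`|b| - 1) <= `|b| ^+ n.
  elim: n => [|n IH]; first by rewrite mul0r expr0 ler01.
  rewrite exprS -[X in X * _ ^+ _](subrK 1) mulrDl mul1r mulrS mulrDl mul1r lerD //.
  by rewrite ler_peMr ?subr_ge0 ?(ltW b1) // exprn_ege1 // ltW.
have d0 : 0 < `|b| - 1 by rewrite subr_gt0.
have [N cN] := archiC (c / (`|b| - 1)).
have c0 : 0 <= c by apply: le_trans (bc 0%N); rewrite expr0 ler01.
have := le_trans (bern N.+1) (bc N.+1); rewrite -ler_pdivlMr //.
have cd0 : 0 <= c / (`|b| - 1) by rewrite divr_ge0 // ltW.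
move: cN; rewrite ger0_norm // => cN.
by move=> /le_trans/(_ cN); rewrite ler_nat ltnn.
Qed.

(** A polynomial [g] vanishing at all elements of [bs] other than [b] combines finitely many shifted
    power sums into a fixed nonzero multiple of a power of [b], which is therefore bounded
    ([key]). *)
Lemma bounded_power_sums (bs : seq C) (c : C) :
  (forall n, `|\sum_(b <- bs) b ^+ n.+1| <= c) ->
  forall b, b \in bs -> `|b| <= 1.
Proof.
move=> sumc b bbs; have [->|b0] := eqVneq b 0; first by rewrite normr0 ler01.
pose g := \prod_(z <- rem b (undup bs)) ('X - z%:P).
have gb : g.[b] != 0.
  by rewrite -rootE root_prod_XsubC mem_rem_uniq ?undup_uniq // inE eqxx.
have gz z : z \in bs -> z != b -> g.[z] = 0.
  move=> zbs zb; apply/rootP; rewrite root_prod_XsubC mem_rem_uniq ?undup_uniq //.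
  by rewrite inE zb mem_undup.
have key n : \sum_(i < size g) g`_i * \sum_(z <- bs) z ^+ (n + i).+1 =
    (count_mem b bs)%:R * (b ^+ n.+1 * g.[b]).
  under eq_bigr => i _ do rewrite mulr_sumr.
  rewrite exchange_big /= -sum1_count natr_sum mulr_suml [RHS]big_mkcond /=.
  apply: eq_big_seq => z zbs /=; rewrite mul1r.
  transitivity (z ^+ n.+1 * g.[z]).
    rewrite horner_coef mulr_sumr; apply: eq_bigr => i _.
    by rewrite -addSn exprD mulrCA.
  by case: eqP => [->//|/eqP zb]; rewrite gz ?mulr0.
pose A := \sum_(i < size g) `|g`_i| * c.
have m0 : 0 < (count_mem b bs)%:R :> C by rewrite ltr0n -has_count has_pred1.
have gb0 : 0 < `|g.[b]| by rewrite normr_gt0.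
have bnd n : `|b| ^+ n.+1 <= A / ((count_mem b bs)%:R * `|g.[b]|).
  rewrite ler_pdivlMr ?mulr_gt0 // mulrCA -normrX -normrM -[X in X * _]ger0_norm ?(ltW m0) //.
  rewrite -normrM -key; apply: le_trans (ler_norm_sum _ _ _) _.
  by apply: ler_sum => i _; rewrite normrM ler_wpM2l.
apply: (@bounded_powers b (1 + A / ((count_mem b bs)%:R * `|g.[b]|))).
have A0 : 0 <= A / ((count_mem b bs)%:R * `|g.[b]|).
  by apply: le_trans (bnd 0%N); rewrite exprn_ge0.
case=> [|n]; first by rewrite expr0 lerDl.
by apply: le_trans (bnd n) _; rewrite lerDr ler01.
Qed.
(* The hypothesis on S at even arguments suffices: it bounds the power sums of
   the squares of the reciprocal roots. *)
Lemma riemann_bound (a S : nat -> C) (D : nat) (c r : C) :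
  a 0%N = 1 -> (forall n, (D < n)%N -> a n = 0) ->
  (forall n, n%:R * a n = \sum_(j < n) S j.+1 * a (n - j.+1)%N) ->
  0 < r -> (forall t, `|S (t.+1).*2| <= c * r ^+ (t.+1).*2) ->
  `|S 1%N| <= D%:R * r.
Proof.
move=> a0 aD aS r0 Sc; have [ws szws aE] := reciprocal_roots a0 aD.
have SE := power_sums_unique a0 aE aS.
have wr w : w \in ws -> `|w| <= r.
  move=> wws; have r2 : 0 < r ^+ 2 by rewrite exprn_gt0.
  suff : `|w ^+ 2 / r ^+ 2| <= 1.
    rewrite normrM normfV [X in _ / X]ger0_norm ?(ltW r2) // ler_pdivrMr // mul1r normrX.
    by rewrite ler_sqr ?nnegrE ?(ltW r0).
  apply: (@bounded_power_sums [seq z ^+ 2 / r ^+ 2 | z <- ws] c); last exact: map_f.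
  move=> n; rewrite big_map.
  under eq_bigr => z _ do rewrite expr_div_n -!exprM.
  rewrite -mulr_suml normrM normfV ler_pdivrMr ?normr_gt0 ?expf_neq0 ?gt_eqF //.
  have := Sc n; rewrite -[n.+1.*2]prednK ?double_gt0 // SE normrN prednK ?double_gt0 //.
  by rewrite mul2n (ger0_norm (exprn_ge0 _ (ltW r0))).
rewrite SE normrN; apply: le_trans (ler_norm_sum _ _ _) _.
apply: (@le_trans _ _ (\sum_(w <- ws) r)).
  by rewrite !big_seq; apply: ler_sum => w /wr; rewrite expr1.
rewrite big_const_seq count_predT iter_addr_0 -[r *+ _]mulr_natl ler_wpM2r ?(ltW r0) //.
by rewrite ler_nat.
Qed.

End ArchimedeanBounds.

(** * Hybrid characters *)

Lemma deriv_prodE (K : fieldType) (I : eqType) (r : seq I) (f : I -> {poly K}) (c : K) :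
  (forall i, (f i).[c] != 0) ->
  (\prod_(i <- r) f i)^`().[c] / (\prod_(i <- r) f i).[c] =
  \sum_(i <- r) (f i)^`().[c] / (f i).[c].
Proof.
move=> f0; elim: r => [|i r IH]; first by rewrite !big_nil poly.derivE horner0 mul0r.
rewrite !big_cons -IH derivM hornerD !hornerM.
have P0 : (\prod_(j <- r) f j).[c] != 0.
  by rewrite horner_prod prodf_seq_neq0; apply/allP => j _; exact: f0.
by field; rewrite f0 P0.
Qed.

Lemma size_prod_deg (K : fieldType) (I : finType) (P : pred I) (f : I -> {poly K})
    (d : nat) :
  (forall i, (size (f i) <= d.+1)%N) -> (size (\prod_(i | P i) f i)%R <= (d * #|P|).+1)%N.
Proof.
move=> sf; rewrite -sum1_card big_distrr /=.
elim/big_rec2: _ => [|i n g _ IH]; first by rewrite size_poly1.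
by rewrite muln1; apply: size_mul_deg.
Qed.

Lemma deriv_double_root (K : fieldType) (f r : {poly K}) (c : K) :
  f.[c] = 0 -> (f ^+ 2 * r)^`().[c] = 0.
Proof.
move=> fc; rewrite derivM deriv_exp !(hornerE, hornerMn) fc.
by rewrite !(mul0r, mulr0, addr0, mul0rn, expr0n).
Qed.

Section HybridCharacter.
Variables (F : finFieldType) (C : numClosedFieldType) (I : finType) (a h : I -> F).
Variables (chi psi : F -> C).
Hypotheses (a_inj : injective a) (h_neq0 : forall i, h i != 0).
Hypotheses (chiM : {morph chi : x y / x * y}) (chi1 : chi 1 = 1).
Hypotheses (psiD : forall x y, psi (x + y) = psi x * psi y) (psi0 : psi 0 = 1).

(* For g = \prod_x ('X - x) this is the opposite of the sum over x of the
   values of \sum_i h i / (x - a i). *)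
Definition logderiv (g : {poly F}) : F := \sum_i h i * (g^`().[a i] / g.[a i]).

Definition pole_free (g : {poly F}) : bool :=
  [forall i, g.[a i] != 0] && (g.[0] != 0).

(** The sign makes the argument of [chi] the product of the roots of a monic [g]. At a norm
    polynomial the arguments thus become the norm of the point and the trace of the rational
    function there. *)
Definition hybrid_char (g : {poly F}) : C :=
  if pole_free g then chi ((-1) ^+ (size g).-1 * g.[0]) * psi (- logderiv g) else 0.

Lemma hybrid_charM : {in monic &, {morph hybrid_char : g1 g2 / g1 * g2}}.
Proof.
move=> g1 g2 m1 m2; rewrite /hybrid_char.
have -> : pole_free (g1 * g2) = pole_free g1 && pole_free g2.
  rewrite /pole_free hornerM mulf_eq0 negb_or andbACA; congr (_ && _).
  apply/forallP/andP => [nz|[/forallP n1 /forallP n2] i]; last first.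
    by rewrite hornerM mulf_neq0.
  by split; apply/forallP => i; have := nz i; rewrite hornerM mulf_eq0 negb_or => /andP[].
have [/andP[/forallP n1 z1]|_] := boolP (pole_free g1); last by rewrite mul0r.
have [/andP[/forallP n2 z2]|_] := boolP (pole_free g2); last by rewrite mulr0.
have -> : logderiv (g1 * g2) = logderiv g1 + logderiv g2.
  rewrite -big_split; apply: eq_bigr => i _ /=.
  rewrite derivM hornerD !hornerM; field.
  by rewrite n1 n2.
rewrite opprD psiD size_Mmonic ?monic_neq0 // hornerM.
have -> : ((size g1 + size g2).-1.-1 = (size g1).-1 + (size g2).-1)%N.
  have : (0 < size g1)%N by rewrite size_poly_gt0 monic_neq0.
  have : (0 < size g2)%N by rewrite size_poly_gt0 monic_neq0.
  lia.
by rewrite exprD mulrACA chiM mulrACA.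
Qed.

Lemma Lcoef0 : Lcoef hybrid_char 0 = 1.
Proof.
rewrite /Lcoef (big_pred1 (0 : 'rV_0)) => [|c]; last by rewrite /= [c]thinmx0 eqxx.
rewrite /monic_of_row linear0 addr0 expr0 /hybrid_char /pole_free.
rewrite !hornerE oner_neq0 andbT ifT; last by apply/forallP => i; rewrite !hornerE oner_neq0.
rewrite size_poly1 expr0 ?mulr1 ?mul1r chi1 mul1r /logderiv big1 ?oppr0 // => i _.
by rewrite poly.derivE horner0 mul0r mulr0.
Qed.

Hypothesis psi_nontrivial : exists y, psi y != 1.

(* Adding a multiple of mo to a monic g keeps g 0, every g (a i) and every
   g' (a i) with i != i0, but moves g' (a i0): the sum over the monic
   polynomials of degree n is invariant under multiplication by psi y. *)
Lemma Lcoef_eq0 (i0 : I) (n : nat) : (2 * #|I| < n)%N -> Lcoef hybrid_char n = 0.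
Proof.
(* The factor [z] makes [mo] vanish at 0. If [a i0 = 0], the factor ['X - (a i0)%:P] already does
   so, and a further ['X] would make [m] vanish at [a i0]. *)
move=> ltn; pose z : {poly F} := if a i0 == 0 then 1 else 'X.
pose m : {poly F} := \prod_(i | i != i0) ('X - (a i)%:P) ^+ 2 * z.
pose mo : {poly F} := ('X - (a i0)%:P) * m.
have mo_a i : mo.[a i] = 0.
  rewrite hornerM; have [->|ii0] := eqVneq i i0; first by rewrite hornerXsubC subrr mul0r.
  have e2 : (('X - (a i)%:P) ^+ 2).[a i] = 0 by rewrite horner_exp hornerXsubC subrr expr0n.
  by rewrite hornerM horner_prod (bigD1 i) //= e2 !mul0r mulr0.
have mo_0 : mo.[0] = 0.
  rewrite !hornerM /z; case: eqVneq => [->|_]; first by rewrite hornerXsubC subrr mul0r.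
  by rewrite hornerX !mulr0.
have mi0 : m.[a i0] != 0.
  rewrite hornerM mulf_neq0 //.
    rewrite horner_prod prodf_seq_neq0; apply/allP => i _; apply/implyP => ii0.
    by rewrite horner_exp !hornerE expf_neq0 // subr_eq0 (inj_eq a_inj) eq_sym.
  by rewrite /z; case: ifPn => [_|a0]; [rewrite hornerC oner_neq0|rewrite hornerX].
have mo'0 : mo^`().[a i0] = m.[a i0].
  by rewrite derivM derivXsubC mul1r hornerD [X in _ + X]hornerM hornerXsubC subrr mul0r addr0.
have mo'_i i : i != i0 -> mo^`().[a i] = 0.
  move=> ii0; rewrite /mo /m (bigD1 i) //=; set r := \prod_(j | _) _.
  have -> : ('X - (a i0)%:P) * (('X - (a i)%:P) ^+ 2 * r * z) =
    ('X - (a i)%:P) ^+ 2 * (('X - (a i0)%:P) * r * z) by ring.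
  by rewrite deriv_double_root // hornerXsubC subrr.
(* The degree of [mo] is at most [2 * #|I|]; this is the origin of the threshold on [n]. *)
have smo : (size mo <= n)%N.
  apply: leq_trans ltn; apply: (@leq_trans (1 + (2 * #|predC1 i0| + 1)).+1); last first.
    by have := cardC1 i0; have : (0 < #|I|)%N by [apply/card_gt0P; exists i0]; lia.
  apply: size_mul_deg; first by rewrite size_XsubC.
  apply: size_mul_deg; last by rewrite /z; case: eqP => _; rewrite ?size_poly1 ?size_polyX.
  by apply: size_prod_deg => i; apply: (@size_exp_deg _ _ 1); rewrite size_XsubC.
have [y psiy] := psi_nontrivial.
(* Adding [lam * g.[a i0]] times [mo] to [g] changes [logderiv g] by [h i0 * lam * m.[a i0] = -
   y]. *)
pose lam := - y / (h i0 * m.[a i0]).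
pose sh (c : 'rV[F]_n) := c + poly_rV ((lam * (monic_of_row c).[a i0]) *: mo).
have shE c : monic_of_row (sh c) = monic_of_row c + (lam * (monic_of_row c).[a i0]) *: mo.
  rewrite /monic_of_row /sh linearD /= poly_rV_K ?addrA //.
  exact: leq_trans (size_scale_leq _ _) smo.
have eva c i : (monic_of_row (sh c)).[a i] = (monic_of_row c).[a i].
  by rewrite shE hornerD hornerZ mo_a mulr0 addr0.
have sh_inj : injective sh.
  move=> c d e; have := congr1 (fun c => (monic_of_row c).[a i0]) e.
  rewrite /= !eva => ev.
  by move: e; rewrite /sh ev => /addIr.
have shPsi c : hybrid_char (monic_of_row (sh c)) = hybrid_char (monic_of_row c) * psi y.
  have ev0 : (monic_of_row (sh c)).[0] = (monic_of_row c).[0].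
    by rewrite shE hornerD hornerZ mo_0 mulr0 addr0.
  rewrite /hybrid_char /pole_free ev0 !size_monic_of_row.
  under eq_forallb => i do rewrite eva.
  case: ifP => [/andP[/forallP nz _]|_]; last by rewrite mul0r.
  rewrite -mulrA -psiD; congr (_ * psi _).
  rewrite /logderiv (bigD1 i0) // [in RHS](bigD1 i0) //= !eva shE derivD derivZ.
  rewrite hornerD hornerZ mo'0 (eq_bigr (fun i => h i * ((monic_of_row c)^`().[a i] / (monic_of_row c).[a i]))).
    by rewrite /lam; field; rewrite nz mi0 h_neq0.
  by move=> i ii0; rewrite !hornerD !hornerZ mo'_i // mo_a !mulr0 !addr0.
have : Lcoef hybrid_char n = Lcoef hybrid_char n * psi y.
  rewrite {1}/Lcoef (reindex_inj sh_inj) /= mulr_suml; apply: eq_bigr => c _; exact: shPsi.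
move/eqP; rewrite -subr_eq0 -{1}[Lcoef _ _]mulr1 -mulrBr mulf_eq0 subr_eq0 [1 == _]eq_sym.
by rewrite (negPf psiy) orbF => /eqP.
Qed.

End HybridCharacter.

(** * Counting points of given norm and trace *)

Lemma closed_rootsX (K : closedFieldType) (n : nat) (y : K) :
  (n%:R : K) != 0 -> y != 0 ->
  {r : seq K | [/\ uniq r, size r = n & {in r, forall w, w ^+ n = y}]}.
Proof.
move=> n0 y0; have [r rE] := closed_field_poly_normal ('X^n - y%:P : {poly K}).
have n_gt0 : (0 < n)%N by case: (n) n0 => //; rewrite eqxx.
have szy : (size (- y%:P : {poly K})%R < n.+1)%N.
  by rewrite size_polyN (leq_ltn_trans (size_polyC_leq1 _)).
have {}rE : 'X^n - y%:P = \prod_(z <- r) ('X - z%:P).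
  by rewrite {1}rE lead_coefDl ?lead_coefXn ?scale1r // size_polyXn.
have rP w : w \in r -> w ^+ n = y.
  by rewrite -root_prod_XsubC -rE rootE !hornerE subr_eq0 => /eqP.
exists r; split=> //; last first.
  by apply/eqP; rewrite -eqSS -(size_prod_XsubC r id) -rE size_polyDl size_polyXn.
rewrite -separable_prod_XsubC -rE separable_poly.unlock.
apply/Bezout_eq1_coprimepP; exists (- (y^-1)%:P, (n%:R * y)^-1 *: 'X) => /=.
have e1 : ((n%:R * y)^-1 *: 'X) * ('X^(n.-1) *+ n) = (y^-1)%:P * 'X^n.
  rewrite -scaler_nat -scalerAr -scalerAl scalerA invfM mulrA mulfV // mul1r.
  by rewrite -exprS prednK // mul_polyC.
rewrite derivB derivXn derivC subr0 e1 mulNr mulrBr -polyCM mulVf //.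
by rewrite opprB subrK.
Qed.

Section ClassBound.
Variables (K : closedFieldType) (p k t : nat) (I : finType) (a h : I -> K).
Hypotheses (pK : p \in [pchar K]) (k_gt0 : (0 < k)%N) (t_gt0 : (0 < t)%N).
Hypotheses (a_inj : injective a) (h_neq0 : forall i, h i != 0).
Local Notation q := (p ^ k)%N.
Local Notation M := (q ^ t)%N.
Local Notation e := (\sum_(i < t.*2) q ^ i)%N.

(** The coefficient of [M] in [stepanov] for [D = q.-1 * m], the degree in [w] of a function with
    [m] poles after the substitution below. *)
Definition stepanov_const (p' q' m : nat) : nat := (p' * (2 * (q'.-1 * m) + 2) + 1)%N.

(* Elements of norm b are substituted as x = gam * w ^+ q.-1, which reduces the
   count to Stepanov's method for a rational function of w. *)
Lemma class_bound (i0 : I) (b c gam : K) (X : seq K) :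
  b != 0 -> gam ^+ e = b -> uniq X ->
  (forall x, x \in X -> [/\ x ^+ (M * M) = x, forall i, x != a i, x ^+ e = b &
      \sum_(l < (k * t).*2) (\sum_i h i / (x - a i)) ^+ (p ^ l) = c]) ->
  (p * (q.-1 * size X) <= M * M + stepanov_const p q #|I| * M)%N.
Proof.
move=> b0 game uX XP.
have p_prime := pcharf_prime pK.
have q_gt1 : (1 < q)%N by rewrite -(exp1n k) ltn_exp2r // prime_gt1.
have t2 : (0 < t.*2)%N by rewrite double_gt0.
(* The norm is the power with exponent [e], where [(q - 1) e = M * M - 1]. *)
have MM : (M * M = (q.-1 * e).+1)%N.
  by rewrite -expnD addnn -predn_exp prednK // expn_gt0 (ltnW q_gt1).
have e_gt0 : (0 < e)%N by rewrite -(prednK t2) big_ord_recl expn0.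
have gam0 : gam != 0.
  by apply: contraNneq b0 => gam0; rewrite -game gam0 expr0n eqn0Ngt e_gt0.
have q1R : (q.-1)%:R = - 1 :> K.
  rewrite -subn1 natrB ?(ltnW q_gt1) // natrX (pcharf0 pK) expr0n.
  by rewrite eqn0Ngt k_gt0 sub0r.
have q1n0 : (q.-1)%:R != 0 :> K by rewrite q1R oppr_eq0 oner_neq0.
have x0 x : x \in X -> x != 0.
  move=> /XP[_ _ xe _]; apply: contraNneq b0 => x0.
  by rewrite -xe x0 expr0n eqn0Ngt e_gt0.
have [r rP] : exists r : K -> seq K, forall x, x \in X ->
    [/\ uniq (r x), size (r x) = q.-1 & {in r x, forall w, w ^+ q.-1 = x / gam}].
  pose ex x (xX : x \in X) := closed_rootsX q1n0 (mulf_neq0 (x0 x xX) (invr_neq0 gam0)).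
  exists (fun x => if @idP (x \in X) is ReflectT xX then sval (ex x xX) else [::]) => x xX.
  case: {-}_ / idP => [xX'|//].
  by case: (ex _ _).
pose W := [seq w | x <- X, w <- r x].
have WP w : w \in W -> exists2 x, x \in X & gam * w ^+ q.-1 = x.
  case/allpairsPdep => x [y [xX yr ->]]; exists x => //.
  by have [_ _ ->] := rP _ xX; rewrite // mulrC divfK.
have szW : size W = (q.-1 * size X)%N.
  rewrite size_allpairs_dep sumnE big_map big_seq.
  rewrite (eq_bigr (fun=> q.-1)) => [|x /rP[]//].
  by rewrite -big_seq big_const_seq count_predT iter_addn addn0.
have uW : uniq W.
  apply: allpairs_uniq_dep => //; first by move=> x /rP[].
  move=> _ _ /allpairsPdep[x [y [xX yr ->]]] /allpairsPdep[x' [y' [xX' yr' ->]]] /= yy'.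
  have [_ _ /(_ _ yr) yE] := rP _ xX; have [_ _ /(_ _ yr') yE'] := rP _ xX'.
  have xx' : x = x' by apply: (mulIf (invr_neq0 gam0)); rewrite -yE -yE' yy'.
  by rewrite xx' yy'.
pose f i : {poly K} := gam *: 'X^(q.-1) - (a i)%:P.
pose B : {poly K} := \prod_i f i.
pose A : {poly K} := \sum_i h i *: \prod_(j | j != i) f j.
have fE i w : (f i).[w] = gam * w ^+ q.-1 - a i by rewrite !hornerE.
have sf i : (size (f i) <= q.-1.+1)%N.
  rewrite (leq_trans (size_polyD _ _)) // geq_max size_polyN.
  rewrite (leq_trans (size_scale_leq _ _)) ?size_polyXn //.
  exact: leq_trans (size_polyC_leq1 _) _.
have sB : (size B <= (q.-1 * #|I|).+1)%N by exact: size_prod_deg.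
have sA : (size A <= (q.-1 * #|I|).+1)%N.
  apply: leq_trans (size_sum _ _ _) _; apply/bigmax_leqP => i _.
  apply: leq_trans (size_scale_leq _ _) _; apply: leq_trans (size_prod_deg _ sf) _.
  by rewrite ltnS leq_mul2l max_card orbT.
have [w0 w0E] : exists w0, gam * w0 ^+ q.-1 = a i0.
  have [|w0 /eqP w0E] := @closed_rootX K q.-1 (a i0 / gam).
    by rewrite -ltnS prednK ?(ltnW q_gt1).
  by exists w0; rewrite w0E mulrC divfK.
pose Bi : {poly K} := \prod_(j | j != i0) f j.
have Bi0 : Bi.[w0] != 0.
  rewrite horner_prod prodf_seq_neq0; apply/allP => j _; apply/implyP => ji0.
  by rewrite fE w0E subr_eq0 (inj_eq a_inj) eq_sym.
have Aw0 : A.[w0] != 0.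
  rewrite horner_sum (bigD1 i0) //= [X in _ + X]big1 => [|i ii0].
    by rewrite addr0 hornerZ mulf_neq0.
  rewrite hornerZ horner_prod (bigD1 i0) 1?eq_sym //= fE w0E subrr mul0r mulr0 //.
(* The order of the pole at [w0], which lies over [a i0]: it is [q - 1] when [a i0 = 0], as then
   [w0 = 0], and 1 otherwise because ['X^(q.-1)] is unramified away from 0. Both are prime to
   [p]. *)
have [m [B' [copm defB B'0]]] : exists m, exists B' : {poly K},
    [/\ coprime m p, B = ('X - w0%:P) ^+ m * B' & B'.[w0] != 0].
  have BE : B = f i0 * Bi by rewrite /B (bigD1 i0).
  have q1_gt0 : (0 < q.-1)%N by rewrite -ltnS prednK ?(ltnW q_gt1).
  have [ai0|ai0] := eqVneq (a i0) 0.
    have w00 : w0 = 0.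
      move: w0E => /eqP; rewrite ai0 mulf_eq0 (negPf gam0) expf_eq0 q1_gt0 /=.
      by move/eqP.
    exists q.-1, (gam *: Bi); split.
    - by rewrite -(coprime_pexpr _ _ k_gt0) coprimePn // ltnW.
    - by rewrite BE /f ai0 w00 !subr0 -scalerAl -scalerAr.
    - by rewrite hornerZ mulf_neq0.
  have w00 : w0 != 0.
    by apply: contraNneq ai0 => w00; rewrite -w0E w00 expr0n eqn0Ngt q1_gt0 mulr0.
  pose s : {poly K} := \sum_(i < q.-1) 'X^(q.-1.-1 - i) * w0%:P ^+ i.
  have fs : f i0 = gam *: (('X - w0%:P) * s).
    by rewrite /f -w0E polyCM polyC_exp -mul_polyC -mulrBr mul_polyC subrXX.
  have s0 : s.[w0] = (q.-1)%:R * w0 ^+ q.-1.-1.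
    rewrite horner_sum (eq_bigr (fun=> w0 ^+ q.-1.-1)) => [|i _].
      by rewrite sumr_const card_ord mulr_natl.
    rewrite hornerM hornerXn horner_exp hornerC -exprD subnK //.
    by rewrite -ltnS prednK.
  exists 1%N, (gam *: (s * Bi)); split; first exact: coprime1n.
    by rewrite BE fs expr1 -scalerAl -scalerAr mulrA.
  by rewrite hornerZ hornerM s0 !mulf_neq0 // expf_neq0.
have [nu nuE] : exists nu, (k * t)%N = nu.+1.
  by exists (k * t).-1; rewrite prednK // muln_gt0 k_gt0.
have ME : M = (p ^ nu.+1)%N by rewrite -nuE expnM.
have := @stepanov K p nu (q.-1 * #|I|) pK A B B' w0 c m sA sB defB B'0 Aw0 copm W uW.
rewrite szW -ME; apply=> w wW; have [x xX gw] := WP w wW; have [xM xa xe xtr] := XP x xX.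
have fx i : (f i).[w] = x - a i by rewrite fE gw.
have Bw : B.[w] != 0.
  rewrite horner_prod prodf_seq_neq0; apply/allP => i _ /=; by rewrite fx subr_eq0.
split=> //.
  (* [w ^+ q.-1 = x / gam] has norm 1, so [w] lies in the field with [M * M] elements. *)
  rewrite MM exprS exprM; suff -> : (w ^+ q.-1) ^+ e = 1 by rewrite mulr1.
  have -> : w ^+ q.-1 = x / gam by rewrite -gw mulrAC mulfV // mul1r.
  by rewrite expr_div_n xe game divff.
rewrite -nuE -xtr; apply: eq_bigr => l _; congr (_ ^+ _).
rewrite horner_sum mulr_suml; apply: eq_bigr => i _.
have -> : B.[w] = (x - a i) * (\prod_(j | j != i) f j).[w].
  by rewrite -fx -hornerM /B (bigD1 i).
rewrite hornerZ invfM mulrACA mulfV ?mulr1 // horner_prod prodf_seq_neq0.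
by apply/allP => j _; rewrite fx subr_eq0 xa implybT.
Qed.
End ClassBound.

(** * The prime subfield and additive characters *)

Section PrimeLog.
Variables (K : fieldType) (p : nat) (pK : p \in [pchar K]).
Let p_prime : prime p := pcharf_prime pK.

(* The representative in [0, p) of an element of the prime subfield. *)
Definition plog (z : K) : nat := find (fun c => c%:R == z) (iota 0 p).

Lemma eq_natr_mod (i j : nat) : (i%:R == j%:R :> K) = (i == j %[mod p])%N.
Proof.
wlog le_ij : i j / (i <= j)%N => [H|].
  by case/orP: (leq_total i j) => /H // {}H; rewrite eq_sym H eq_sym.
by rewrite eq_sym -subr_eq0 -natrB // -(dvdn_pcharf pK) [RHS]eq_sym eqn_mod_dvd.
Qed.

(** A [z] outside the [p] values [c%:R] would be one root too many of [X^p - X]. *)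
Lemma plogP (z : K) : z ^+ p = z -> (plog z < p)%N /\ (plog z)%:R = z.
Proof.
move=> zp; have p1 := prime_gt1 p_prime.
have hz : has (fun c => c%:R == z) (iota 0 p).
  apply/negPn/negP => nhz.
  have := @size_roots_exp K p (z :: [seq c%:R | c <- iota 0 p]) p1.
  rewrite /= size_map size_iota ltnn => H; suff : false by []; apply: H.
    apply/andP; split.
      by apply: contra nhz => /mapP[c ci ->]; apply/hasP; exists c.
    rewrite map_inj_in_uniq ?iota_uniq // => i j.
    rewrite !mem_iota !add0n /= => ip jp /eqP; rewrite eq_natr_mod !modn_small //.
    by move/eqP.
  move=> x; rewrite inE => /orP[/eqP -> //|/mapP[c _ ->]].
  by have := pFrobenius_aut_nat pK c.
have := hz; rewrite has_find size_iota => lt_p; split=> //.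
by have /eqP := nth_find 0%N hz; rewrite nth_iota.
Qed.

Lemma plog_natr (z : K) (c : nat) : z ^+ p = z -> (c < p)%N ->
  (plog z == c) = (z == c%:R).
Proof.
move=> /plogP[lt_p zE] lt_c; rewrite -{2}zE eq_natr_mod !modn_small //.
Qed.

End PrimeLog.

Section AdditiveCharacter.
Variables (F : finFieldType) (C : numClosedFieldType) (p k : nat).
Hypotheses (pF : p \in [pchar F]) (k_gt0 : (0 < k)%N) (cardF : #|F| = (p ^ k)%N).
Variable zeta : C.
Hypothesis zeta_prim : p.-primitive_root zeta.
Let p_prime : prime p := pcharf_prime pF.

Definition abs_trace (y : F) : F := \sum_(l < k) y ^+ (p ^ l).
Definition add_char (y : F) : C := zeta ^+ plog p (abs_trace y).

Lemma abs_traceX y : abs_trace y ^+ p = abs_trace y.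
Proof.
rewrite /abs_trace -[X in _ ^+ X = _]expn1 expr_sum_pchar //.
rewrite (eq_bigr (fun l : 'I_k => y ^+ (p ^ l.+1))) => [|l _]; last first.
  by rewrite -exprM expn1 -expnSr.
case: k k_gt0 cardF => // k' _ cF; rewrite big_ord_recr [RHS]big_ord_recl /=.
by rewrite -cF expf_card addrC expn0 expr1.
Qed.

Lemma abs_traceD x y : abs_trace (x + y) = abs_trace x + abs_trace y.
Proof.
rewrite /abs_trace -big_split; apply: eq_bigr => l _.
by rewrite exprDn_pchar // (eq_pnat _ (pcharf_eq pF)) pnatX pnat_id.
Qed.

Lemma abs_trace0 : abs_trace 0 = 0.
Proof. by apply: (addrI (abs_trace 0)); rewrite -abs_traceD !addr0. Qed.

Lemma add_char_natr (c : nat) y : abs_trace y = c%:R -> add_char y = zeta ^+ c.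
Proof.
move=> yc; apply/eqP; rewrite (eq_prim_root_expr zeta_prim) -(eq_natr_mod pF).
by have [_ ->] := plogP pF (abs_traceX y); rewrite yc.
Qed.

Lemma add_charD x y : add_char (x + y) = add_char x * add_char y.
Proof.
rewrite -exprD; apply: add_char_natr; rewrite abs_traceD natrD.
by have [_ ->] := plogP pF (abs_traceX x); have [_ ->] := plogP pF (abs_traceX y).
Qed.

Lemma add_char0 : add_char 0 = 1.
Proof. by rewrite (@add_char_natr 0) ?expr0 // abs_trace0. Qed.

(** The trace is given by a nonzero polynomial of degree [p ^ k.-1], too small to vanish on all of
    [F]. *)
Lemma abs_trace_neq0 : exists y, abs_trace y != 0.
Proof.
pose T : {poly F} := \sum_(l < k) 'X^(p ^ l).
have T0 : T != 0.
  apply/eqP => /polyP/(_ 1%N); rewrite coef0 coef_sum -(prednK k_gt0) big_ord_recl.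
  rewrite expn0 coefX /= big1 ?addr0 => [/eqP|l _]; first by rewrite oner_eq0.
  rewrite coefXn /bump /= -(expn0 p) eqn_exp2l ?prime_gt1 //.
have [/forallP trF|] := boolP [forall y, abs_trace y == 0]; last first.
  by rewrite negb_forall => /existsP.
have := @max_poly_roots F T (enum F) T0 _ (enum_uniq F).
have -> : all (root T) (enum F).
  apply/allP => y _; rewrite rootE horner_sum.
  by under eq_bigr => l _ do rewrite hornerXn; exact: trF.
move=> /(_ isT); rewrite -cardE cardF ltnNge; case/negP.
apply: leq_trans (size_sum _ _ _) _; apply/bigmax_leqP => l _.
by rewrite size_polyXn ltn_exp2l ?prime_gt1.
Qed.

Lemma add_char_neq1 : exists y, add_char y != 1.
Proof.
have [y y0] := abs_trace_neq0; exists y; have [lt_p yE] := plogP pF (abs_traceX y).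
rewrite -(prim_order_dvd zeta_prim); apply: contraNN y0 => dv.
by rewrite -yE -(dvdn_pcharf pF).
Qed.

Lemma add_char_norm y : `|add_char y| = 1.
Proof.
apply/eqP; rewrite normrX -(@pexpr_eq1 _ _ p) ?exprn_ge0 ?prime_gt0 //.
by rewrite -exprM mulnC exprM -normrX (prim_expr_order zeta_prim) normr1 expr1n.
Qed.

End AdditiveCharacter.

(* Upper bounds for all the class sizes N j, together with their total, also
   bound each of them from below. *)
Lemma equidistribution_bound (C : numClosedFieldType) (J : finType) (P : pred J)
    (w : J -> C) (N : J -> nat) (U : nat) :
  (exists j, P j) -> \sum_(j | P j) w j = 0 -> (forall j, P j -> `|w j| <= 1) ->
  (forall j, P j -> (#|P| * N j <= U)%N) ->
  `|\sum_(j | P j) w j * (N j)%:R| <= U%:R - (\sum_(j | P j) N j)%:R.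
Proof.
move=> [j0 Pj0] w0 w1 NU.
have cP : (0 : C) < #|P|%:R by rewrite ltr0n; apply/card_gt0P; exists j0.
rewrite -(ler_pM2l cP) -[X in X * `|_|]ger0_norm ?(ltW cP) // -normrM.
have -> : #|P|%:R * (\sum_(j | P j) w j * (N j)%:R) =
    - \sum_(j | P j) w j * (U%:R - (#|P| * N j)%:R).
  under [in RHS]eq_bigr => j _ do rewrite mulrBr.
  rewrite sumrB -mulr_suml w0 mul0r sub0r opprK mulr_sumr.
  by apply: eq_bigr => j _; rewrite natrM mulrCA.
rewrite normrN; apply: le_trans (ler_norm_sum _ _ _) _.
apply: (@le_trans _ _ (\sum_(j | P j) (U%:R - (#|P| * N j)%:R))).
  apply: ler_sum => j Pj; rewrite normrM [X in _ * X]ger0_norm ?subr_ge0 ?ler_nat ?NU //.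
  by rewrite ler_piMl ?w1 // subr_ge0 ler_nat NU.
rewrite sumrB sumr_const mulrBr mulr_natl lerD2l lerN2 natr_sum mulr_sumr.
by apply: ler_sum => j _; rewrite natrM.
Qed.

(** * The Weil bound *)

Section WeilBound.
Variables (F : finFieldType) (C : numClosedFieldType) (p k : nat).
Hypotheses (pF : p \in [pchar F]) (k_gt0 : (0 < k)%N) (cardF : #|F| = (p ^ k)%N).
Variables (zeta : C) (chi : F -> C) (I : finType) (a h : I -> F).
Hypothesis zeta_prim : p.-primitive_root zeta.
Hypotheses (chiM : {morph chi : x y / x * y}) (chi1 : chi 1 = 1).
Hypothesis chi_norm : forall x, x != 0 -> `|chi x| <= 1.
Hypotheses (a_inj : injective a) (h_neq0 : forall i, h i != 0).
Local Notation q := (p ^ k)%N.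
Local Notation psi := (add_char p k zeta).
Local Notation Psi := (hybrid_char a h chi psi).
Let p_prime : prime p := pcharf_prime pF.

Let q_gt1 : (1 < q)%N.
Proof. by rewrite -(exp1n k) ltn_exp2r // prime_gt1. Qed.

Section InClosure.
Variables (K : closedFieldType) (iota : {rmorphism F -> K}).
Let pK : p \in [pchar K]. Proof. by rewrite (fmorph_pchar iota). Qed.
Local Notation norm_poly := (norm_poly iota p k).

Definition rat_fun (x : K) : K := \sum_i iota (h i) / (x - iota (a i)).
Definition nonpole (x : K) : bool := (x != 0) && [forall i, x != iota (a i)].

Let iotaX i (c : F) : iota c ^+ (q ^ i) = iota c.
Proof.
elim: i => [|i IH]; first by rewrite expr1.
by rewrite expnS exprM (iota_frob _ cardF).
Qed.

Let frobB i (x : K) (c : F) : (x - iota c) ^+ (q ^ i) = x ^+ (q ^ i) - iota c.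
Proof. by rewrite -{1}expnM (exprB_pchar _ _ _ pK) !expnM iotaX. Qed.

Lemma normK_horner n (x : K) (c : F) :
  (normK p k n x).[iota c] = \prod_(i < n) (iota c - x ^+ (q ^ i)).
Proof. by rewrite horner_prod; apply: eq_bigr => i _; rewrite hornerXsubC. Qed.

Lemma norm_poly_horner n (x : K) (c : F) : x ^+ (q ^ n) = x ->
  iota (norm_poly n x).[c] = \prod_(i < n) (iota c - x ^+ (q ^ i)).
Proof.
by move=> xn; rewrite -normK_horner -(norm_polyE iota pK k_gt0 cardF xn) horner_map.
Qed.

Lemma norm_pole_free n (x : K) : x ^+ (q ^ n.+1) = x ->
  pole_free a (norm_poly n.+1 x) = nonpole x.
Proof.
move=> xn; have horn c : ((norm_poly n.+1 x).[c] != 0) = (x != iota c).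
  rewrite -(fmorph_eq0 iota) norm_poly_horner //.
  apply/idP/idP => [|xc].
    by apply: contraNN => /eqP ->; rewrite big_ord_recl expr1 subrr mul0r.
  rewrite prodf_seq_neq0; apply/allP => i _ /=; rewrite -opprB oppr_eq0 -frobB.
  by rewrite expf_neq0 // subr_eq0.
rewrite /pole_free /nonpole horn rmorph0 andbC; congr (_ && _).
by apply: eq_forallb => i; rewrite horn.
Qed.

Lemma norm_chi n (x : K) : x ^+ (q ^ n) = x ->
  iota ((-1) ^+ (size (norm_poly n x)).-1 * (norm_poly n x).[0]) =
  x ^+ (\sum_(i < n) q ^ i).
Proof.
move=> xn; rewrite rmorphM /= norm_poly_horner // rmorph0.
rewrite (size_norm_poly iota pK k_gt0 cardF xn) /= rmorphXn rmorphN1 expr_sum.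
under [X in _ * X]eq_bigr => i _ do rewrite sub0r.
by rewrite prodrN card_ord mulrA -exprMn mulrNN mulr1 expr1n mul1r.
Qed.

Lemma norm_logderiv n (x : K) : x ^+ (q ^ n) = x -> nonpole x ->
  iota (- logderiv a h (norm_poly n x)) = \sum_(i < n) rat_fun x ^+ (q ^ i).
Proof.
move=> xn /andP[_ /forallP xa]; rewrite rmorphN rmorph_sum -sumrN /rat_fun.
under [RHS]eq_bigr => i _ do rewrite -expnM expr_sum_pchar //.
rewrite exchange_big; apply: eq_bigr => j _ /=.
rewrite rmorphM /= fmorph_div /= -!horner_map -deriv_map.
rewrite (norm_polyE iota pK k_gt0 cardF xn) deriv_prodE => [|i].
  rewrite mulr_sumr -sumrN; apply: eq_bigr => i _.
  rewrite derivXsubC hornerC hornerXsubC expr_div_n !expnM iotaX frobB.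
  by rewrite -opprB mul1r invrN mulrN opprK.
by rewrite hornerXsubC -opprB oppr_eq0 -frobB expf_neq0 // subr_eq0.
Qed.

(** Transitivity of the trace: the trace down to [F] followed by the absolute trace of [F] is a sum
    of [k * n] Frobenius powers. It is read in [K], where the point counts take place. *)
Lemma norm_add_char n (x : K) : x ^+ (q ^ n) = x -> nonpole x ->
  psi (- logderiv a h (norm_poly n x)) =
  zeta ^+ plog p (\sum_(l < k * n) rat_fun x ^+ (p ^ l)).
Proof.
move=> xn xp; have tE : \sum_(l < k * n) rat_fun x ^+ (p ^ l) =
    iota (abs_trace p k (- logderiv a h (norm_poly n x))).
  rewrite rmorph_sum /=.
  under [RHS]eq_bigr => l _ do rewrite rmorphXn /= norm_logderiv // expr_sum_pchar //.
  rewrite exchange_big /=.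
  under [RHS]eq_bigr => i _ do under eq_bigr => l _ do rewrite -exprM -expnM -expnD.
  elim: n {xn} => [|n IH]; first by rewrite muln0 !big_ord0.
  by rewrite mulnS addnC big_split_ord IH big_ord_recr.
congr (_ ^+ _); rewrite tE /plog; apply: eq_find => c.
by rewrite -(inj_eq (fmorph_inj iota)) rmorph_nat.
Qed.

Lemma rat_funX n (x : K) : rat_fun x ^+ (q ^ n) = rat_fun (x ^+ (q ^ n)).
Proof.
rewrite /rat_fun -{1}expnM expr_sum_pchar //; apply: eq_bigr => i _.
by rewrite expr_div_n !expnM iotaX frobB.
Qed.

Lemma trace_fixed e (y : K) : y ^+ (p ^ e) = y ->
  (\sum_(l < e) y ^+ (p ^ l)) ^+ p = \sum_(l < e) y ^+ (p ^ l).
Proof.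
move=> ye; rewrite -[X in _ ^+ X = _]expn1 expr_sum_pchar //.
rewrite (eq_bigr (fun l : 'I_e => y ^+ (p ^ l.+1))) => [|l _]; last first.
  by rewrite -exprM expn1 -expnSr.
case: e ye => [|e] ye; first by rewrite !big_ord0.
by rewrite big_ord_recr [RHS]big_ord_recl /= ye addrC expn0 expr1.
Qed.

(** The points outside the poles are grouped into classes by norm [b != 0] and trace [c], on which
    the summand is the constant [chi b * zeta ^+ c]. [class_bound] limits each class, and the
    weights cancel in the sum over [c]. *)
Lemma Lsum_even_bound (i0 : I) (t : nat) :
  `|Lsum iota p k Psi (t.+1).*2| <=
     ((stepanov_const p q #|I| + #|I| + 1) * q ^ t.+1)%:R.
Proof.
pose n := (t.+1).*2; pose M := (q ^ t.+1)%N.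
pose G := [seq x <- fixed K p k n | nonpole x].
pose be (x : K) : F := (-1) ^+ (size (norm_poly n x)).-1 * (norm_poly n x).[0].
pose ka (x : K) : nat := plog p (\sum_(l < k * n) rat_fun x ^+ (p ^ l)).
have fixE x : (x \in fixed K p k n) = (x ^+ (q ^ n) == x) by exact: mem_fixed.
have GP x : x \in G -> x ^+ (q ^ n) = x /\ nonpole x.
  by rewrite mem_filter fixE => /andP[? /eqP].
have trp x : x ^+ (q ^ n) = x ->
    (\sum_(l < k * n) rat_fun x ^+ (p ^ l)) ^+ p = \sum_(l < k * n) rat_fun x ^+ (p ^ l).
  by move=> xn; apply: trace_fixed; rewrite expnM rat_funX xn.
have ka_p x : x \in G -> (ka x < p)%N.
  by move=> /GP[xn _]; have [] := plogP pK (trp x xn).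
have be0 x : x \in G -> be x != 0.
  move=> /GP[xn /andP[x0 _]]; rewrite -(fmorph_eq0 iota) norm_chi // expf_neq0 //.
pose N (j : F * 'I_p) : nat := count (fun x => (be x == j.1) && (ka x == j.2)) G.
have jne x b (c : 'I_p) (xG : x \in G) : (b, c) != (be x, Ordinal (ka_p x xG)) ->
    ~~ ((be x == b) && (ka x == c)).
  by apply: contraNN => /andP[/eqP <- /eqP kac]; apply/eqP; congr (_, _); apply: val_inj.
have -> : Lsum iota p k Psi n =
    \sum_(j : F * 'I_p | j.1 != 0) (chi j.1 * zeta ^+ j.2) * (N j)%:R.
  transitivity (\sum_(x <- G) chi (be x) * zeta ^+ ka x).
    rewrite /Lsum big_filter [RHS]big_mkcond /= !big_seq; apply: eq_bigr => x.
    rewrite fixE => /eqP xn; rewrite /hybrid_char norm_pole_free //.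
    by case: ifP => // xp; rewrite norm_add_char.
  under [RHS]eq_bigr => j _ do rewrite /N -sum_nat_count natr_sum mulr_sumr.
  rewrite exchange_big /= !big_seq; apply: eq_bigr => x xG.
  rewrite (bigD1 (be x, Ordinal (ka_p x xG))) ?be0 //= !eqxx mulr1.
  rewrite big1 ?addr0 // => -[b c] /andP[_ ne].
  by rewrite (negPf (jne _ _ _ xG ne)) mulr0.
have sN : (\sum_(j : F * 'I_p | j.1 != 0%R) N j = size G)%N.
  under eq_bigr => j _ do rewrite /N -sum_nat_count.
  rewrite exchange_big /= -sum1_size !big_seq; apply: eq_bigr => x xG.
  rewrite (bigD1 (be x, Ordinal (ka_p x xG))) ?be0 //= !eqxx.
  rewrite big1 // => -[b c] /andP[_ ne].
  by rewrite (negPf (jne _ _ _ xG ne)).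
apply: le_trans (equidistribution_bound
  (U := (M * M + stepanov_const p q #|I| * M)%N) _ _ _ _) _.
- by exists (1, Ordinal (prime_gt0 p_prime)); rewrite /= oner_neq0.
- transitivity (\sum_(b | b != 0) \sum_(c < p) chi b * zeta ^+ c).
    by rewrite pair_big; apply: eq_bigl => j; rewrite /= andbT.
  under eq_bigr => b _ do rewrite -mulr_sumr.
  rewrite -mulr_suml; apply/eqP; rewrite mulf_eq0; apply/orP; right.
  have z1 : zeta != 1.
    have := prim_order_dvd zeta_prim 1; rewrite expr1 => <-.
    by rewrite gtnNdvd ?prime_gt1.
  rewrite -[_ == 0]orFb -{1}(negPf z1) -subr_eq0 -mulf_eq0 -subrX1.
  by rewrite (prim_expr_order zeta_prim) subrr.
- move=> [b c] /= b0; have z1 : `|zeta| = 1.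
    apply/eqP; rewrite -(@pexpr_eq1 _ _ p) ?prime_gt0 // -normrX.
    by rewrite (prim_expr_order zeta_prim) normr1.
  by rewrite normrM normrX z1 expr1n mulr1 chi_norm.
- move=> [b c] /= b0.
  have -> : #|[pred j : F * 'I_p | j.1 != 0]| = (p * q.-1)%N.
    rewrite -cardF -(cardC1 (0 : F)) -[X in (X * _)%N]card_ord mulnC -cardX.
    by apply: eq_card => -[b' c']; rewrite !inE /= andbT.
  have e_gt0 : (0 < \sum_(i < n) q ^ i)%N by rewrite /n doubleS big_ord_recl.
  have [gam /eqP gamE] := closed_rootX (iota b) e_gt0.
  rewrite -mulnA /N -size_filter.
  apply: (@class_bound K p k t.+1 I (iota \o a) (iota \o h) pK k_gt0 _ _ _ i0 (iota b)
    (c%:R) gam) => //.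
  + by move=> u v /fmorph_inj/a_inj.
  + by move=> i; rewrite fmorph_eq0.
  + by rewrite fmorph_eq0.
  + by rewrite filter_uniq // filter_uniq // fixed_uniq.
  move=> x; rewrite mem_filter => /andP[/andP[/= /eqP beb kac] xG].
  have [xn /andP[_ /forallP xa]] := GP x xG; split=> //.
  + by rewrite -expnD addnn.
  + by rewrite -norm_chi // -beb.
  by apply/eqP; rewrite doubleMr -(plog_natr pK (trp x xn)) ?ltn_ord.
(* Only 0 and the poles, at most [#|I|.+1] of the [M * M] points, are missing from the classes. *)
rewrite sN lerBlDr -natrD ler_nat !mulnDl -!addnA addnCA leq_add2l mul1n.
have : (size G + size [seq x <- fixed K p k n | ~~ nonpole x] = M * M)%N.
  have -> : (M * M = q ^ n)%N by rewrite -expnD addnn.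
  by rewrite !size_filter count_predC size_fixed.
have : (size [seq x <- fixed K p k n | ~~ nonpole x] <= #|I|.+1)%N.
  have -> : #|I|.+1 = size (0 :: [seq iota (a i) | i <- enum I]).
    by rewrite /= size_map -cardE.
  apply: uniq_leq_size; first by rewrite filter_uniq // fixed_uniq.
  move=> x; rewrite mem_filter negb_and negbK inE => /andP[/orP[->//|]].
  rewrite negb_forall; case/existsP => i; rewrite negbK => /eqP -> _.
  by apply/orP; right; apply: map_f; rewrite mem_enum.
have M0 : (0 < M)%N by rewrite expn_gt0 (ltnW q_gt1).
by have := leq_mul (leqnn #|I|.+1) M0; rewrite muln1 mulSn; lia.
Qed.

Lemma Lsum1 :
  Lsum iota p k Psi 1 =
  \sum_(y | (y != 0) && [forall i, y != a i]) chi y * psi (\sum_i h i / (y - a i)).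
Proof.
have ffix : perm_eq (fixed K p k 1) [seq iota y | y <- enum F].
  apply: uniq_perm; first exact: fixed_uniq.
    by rewrite map_inj_uniq ?enum_uniq //; apply: fmorph_inj.
  move=> x; rewrite mem_fixed // expn1; apply/eqP/mapP => [xq|[y _ ->]].
    have [y /eqP yx] := fixed_iota iota cardF xq.
    by exists y; rewrite ?mem_enum.
  by rewrite (iota_frob _ cardF).
rewrite /Lsum (perm_big _ ffix) big_map big_enum [RHS]big_mkcond /=.
apply: eq_bigr => y _.
have -> : norm_poly 1 (iota y) = 'X - y%:P.
  have y1 : iota y ^+ (q ^ 1) = iota y by rewrite expn1 (iota_frob _ cardF).
  apply: (map_poly_inj iota); rewrite (norm_polyE iota pK k_gt0 cardF y1).
  by rewrite /normK big_ord1 expn0 expr1 rmorphB /= map_polyX map_polyC.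
rewrite /hybrid_char /pole_free hornerXsubC sub0r oppr_eq0 andbC.
have -> : [forall i, ('X - y%:P).[a i] != 0] = [forall i, y != a i].
  by apply: eq_forallb => i; rewrite hornerXsubC subr_eq0 eq_sym.
case: ifP => // _; rewrite size_XsubC expr1 mulrNN mul1r; congr (_ * psi _).
rewrite /logderiv -sumrN; apply: eq_bigr => i _.
by rewrite derivXsubC hornerC hornerXsubC -opprB mul1r invrN mulrN opprK.
Qed.

End InClosure.

Hypothesis archiC : forall x : C, exists n : nat, `|x| <= n%:R.

Theorem hybrid_weil_bound (i0 : I) (r : C) : 0 < r -> r ^+ 2 = q%:R ->
  `|\sum_(y | (y != 0) && [forall i, y != a i]) chi y * psi (\sum_i h i / (y - a i))|
    <= (2 * #|I|)%:R * r.
Proof.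
move=> r0 r2; have [K [iota _]] := countable_algebraic_closure F.
have pK : p \in [pchar K] by rewrite (fmorph_pchar iota).
rewrite -(Lsum1 iota).
have psi1 := add_char_neq1 pF k_gt0 cardF zeta_prim.
have psiD := add_charD pF k_gt0 cardF zeta_prim.
have psi0 := add_char0 pF k_gt0 cardF zeta_prim.
apply: (@riemann_bound C archiC (Lcoef Psi) (Lsum iota p k Psi) (2 * #|I|)%N
  (stepanov_const p q #|I| + #|I| + 1)%:R).
- exact: Lcoef0.
- by move=> n; apply: Lcoef_eq0.
- by move=> n; apply: newton_Lcoef => //; apply: hybrid_charM.
- exact: r0.
move=> t; rewrite -[(t.+1).*2]mul2n exprM r2 -natrX -natrM mul2n.
exact: Lsum_even_bound.
Qed.

End WeilBound.

(** * Sums over the inversive generators *)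

Lemma prim_root_exists (C : numClosedFieldType) (n : nat) :
  (0 < n)%N -> exists z : C, n.-primitive_root z.
Proof.
move=> n0; have nC : (n%:R : C) != 0 by rewrite pnatr_eq0 -lt0n.
have [r [ur sr rP]] := closed_rootsX nC (oner_neq0 C).
have /hasP[z _ zp] : has n.-primitive_root r.
  apply: has_prim_root; rewrite ?sr //.
  by apply/allP => z zr; apply/unity_rootP; exact: rP.
by exists z.
Qed.

Section FiniteFieldCharacters.
Variables (F : finFieldType) (C : numClosedFieldType).

Let expf_card_pred (x : F) : x != 0 -> x ^+ #|F|.-1 = 1.
Proof.
move=> x0; apply: (mulfI x0); rewrite -exprS prednK ?expf_card ?mulr1 //.
by apply/card_gt0P; exists 0.
Qed.

Lemma finField_generator : exists g : F,
  #|F|.-1.-primitive_root g /\ forall x, x != 0 -> exists i, x = g ^+ i.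
Proof.
have cF : size [seq x <- enum F | x != 0] = #|F|.-1.
  rewrite -(cardC1 (0 : F)) cardE /enum_mem; congr size.
  by rewrite -filter_predI; apply: eq_filter => x; rewrite !inE andbT.
have c1 : (1 < #|F|)%N := finNzRing_gt1 F.
have q1 : (0 < #|F|.-1)%N by case: #|F| c1 => [|[]].
have /hasP[g _ gp] : has #|F|.-1.-primitive_root [seq x <- enum F | x != 0].
  apply: has_prim_root; rewrite ?cF //; last exact: filter_uniq (enum_uniq F).
  apply/allP => x; rewrite mem_filter => /andP[x0 _]; apply/unity_rootP.
  exact: expf_card_pred.
exists g; split=> // x x0; have [i ->] := prim_rootP gp (expf_card_pred x0).
by exists i.
Qed.

(** The characters trivial on the subgroup generated by [theta], extended by 0: with
    [#|F|.-1 = d * T], a generator [g] and [xi] of order [d], the [l]-th one sends [g ^+ i] to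
    [xi ^+ (i * l)]. The subgroup is cut out by [x ^+ T = 1], that is, by [d] dividing [i]. *)
Lemma subgroup_characters (theta : F) (T : nat) :
  theta != 0 -> T.-primitive_root theta -> exists (d : nat) (chi : nat -> F -> C),
  [/\ (0 < d)%N,
   forall l, [/\ {morph chi l : x y / x * y}, chi l 1 = 1 & forall x, `|chi l x| <= 1] &
   forall x, x != 0 -> \sum_(l < d) chi l x = if x ^+ T == 1 then d%:R else 0].
Proof.
move=> th0 thT; have [g [gp gE]] := finField_generator.
have q1 : (0 < #|F|.-1)%N := prim_order_gt0 gp.
have Tq : (T %| #|F|.-1)%N by rewrite (prim_order_dvd thT) expf_card_pred.
have /dvdnP[d dT] := Tq; have d0 : (0 < d)%N by case: (d) dT q1 => // ->.
have dq : (d %| #|F|.-1)%N by rewrite dT dvdn_mulr.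
have T0 : (0 < T)%N := prim_order_gt0 thT.
have [lg lgE] : exists lg : F -> nat, forall x, x != 0 -> g ^+ lg x = x.
  exists (fun x => if [pick i : 'I_#|F|.-1 | g ^+ i == x] is Some i then i : nat else 0%N).
  move=> x x0; case: pickP => [i /eqP //|noi].
  have [i xi] := prim_rootP gp (expf_card_pred x0).
  by have := noi i; rewrite xi eqxx.
have [xi xip] := prim_root_exists C d0.
have lgd i x : x != 0 -> g ^+ i = x -> xi ^+ i = xi ^+ lg x.
  move=> x0 ix; apply/eqP; rewrite (eq_prim_root_expr xip).
  have : (i == lg x %[mod #|F|.-1])%N by rewrite -(eq_prim_root_expr gp) ix lgE.
  by move=> /eqP e; rewrite -(modn_dvdm i dq) e modn_dvdm.
have xi1 : `|xi| = 1.
  apply/eqP; rewrite -(@pexpr_eq1 _ _ d) // -normrX.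
  by rewrite (prim_expr_order xip) normr1.
exists d, (fun l x => if x == 0 then 0 else (xi ^+ lg x) ^+ l); split=> // [l|x x0].
  split=> [x y||x].
  - have [->|x0] := eqVneq x 0; first by rewrite !mul0r eqxx.
    have [->|y0] := eqVneq y 0; first by rewrite !mulr0 eqxx.
    rewrite mulf_eq0 (negPf x0) (negPf y0) /= -exprMn -exprD; congr (_ ^+ _).
    by symmetry; apply: lgd; rewrite ?mulf_neq0 // exprD !lgE.
  - by rewrite oner_eq0 -(lgd 0%N) ?oner_neq0 ?expr0 ?expr1n.
  by case: eqP; rewrite ?normr0 ?ler01 // !normrX xi1 !expr1n lexx.
rewrite (negPf x0).
have -> : (x ^+ T == 1) = (xi ^+ lg x == 1).
  rewrite -{1}(lgE x x0) -exprM -(prim_order_dvd gp) -(prim_order_dvd xip) dT.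
  by rewrite dvdn_pmul2r.
have [->|z1] := eqVneq.
  by under eq_bigr => l _ do rewrite expr1n; rewrite sumr_const card_ord.
apply/eqP; rewrite -[_ == 0]orFb -{1}(negPf z1) -subr_eq0 -mulf_eq0 -subrX1.
by rewrite exprAC (prim_expr_order xip) expr1n subrr.
Qed.

End FiniteFieldCharacters.

Section InversiveSums.
Variables (F : finFieldType) (C : numClosedFieldType) (p k : nat).
Hypotheses (pF : p \in [pchar F]) (k_gt0 : (0 < k)%N) (cardF : #|F| = (p ^ k)%N).
Hypothesis archiC : forall x : C, exists n : nat, `|x| <= n%:R.
Variables (zeta r : C).
Hypothesis zeta_prim : p.-primitive_root zeta.
Hypotheses (r_gt0 : 0 < r) (r2 : r ^+ 2 = (p ^ k)%:R).
Variables (s : nat) (v f : 'I_s -> F).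
Hypotheses (v_inj : injective v).
Local Notation psi := (add_char p k zeta).
Local Notation m := #|[pred i | f i != 0]|.
Hypothesis m_gt0 : (0 < m)%N.

Definition inv_sum (y : F) : F := \sum_i f i * (y + v i)^-1.
Let npole (y : F) := [forall i, (f i != 0) ==> (y != - v i)].

Let m1 : (1 : C) <= m%:R. Proof. by rewrite ler1n. Qed.

Lemma inv_sum_weil (chi : F -> C) : {morph chi : x y / x * y} -> chi 1 = 1 ->
  (forall x, `|chi x| <= 1) ->
  `|\sum_(y | (y != 0) && npole y) chi y * psi (inv_sum y)| <= (2 * m)%:R * r.
Proof.
move=> chiM chi1 chi_le.
pose I := {i : 'I_s | f i != 0}.
have cI : #|{: I}| = m by rewrite card_sig.
have /card_gt0P[i0 fi0] := m_gt0.
have a_inj : injective (fun i : I => - v (val i)) by move=> i j /oppr_inj/v_inj/val_inj.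
have := @hybrid_weil_bound F C p k pF k_gt0 cardF zeta chi I (fun i => - v (val i))
  (fun i => f (val i)) zeta_prim chiM chi1 (fun x _ => chi_le x) a_inj (fun i => valP i)
  archiC (Sub i0 fi0) r r_gt0 r2.
rewrite cI; congr (`|_| <= _); apply: eq_big => [y|y _].
  congr (_ && _); apply/forallP/forallP => [yP i|yP i]; last first.
    by have /implyP := yP (val i); apply; exact: (valP i).
  by apply/implyP => fi; exact: (yP (Sub i fi)).
congr (_ * psi _); rewrite /inv_sum (bigID [pred i | f i != 0]) /= [X in _ + X]big1 ?addr0.
  rewrite (big_sub [pred i | f i != 0] (fun i => f i * (y + v i)^-1)) /=.
  by apply: eq_bigr => i _; rewrite opprK.
by move=> i; rewrite negbK => /eqP ->; rewrite mul0r.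
Qed.

Let psi_norm (y : F) : `|psi y| = 1. Proof. exact: add_char_norm. Qed.

Let card_pole (P : pred F) : (#|[pred y | P y && ~~ npole y]| <= m)%N.
Proof.
apply: (@leq_trans #|[seq - v i | i in [pred i | f i != 0]]|).
  apply: subset_leq_card; apply/fintype.subsetP => y; rewrite !inE => /andP[_].
  rewrite negb_forall; case/existsP => i; rewrite negb_imply negbK => /andP[fi /eqP ->].
  by apply/fintype.imageP; exists i.
exact: leq_image_card.
Qed.

(** [inv_sum] is defined at the poles too, as [0^-1 = 0]. There are at most [m] of them, each
    contributing a term of modulus at most 1. *)
Lemma inv_sum_character (chi : F -> C) : {morph chi : x y / x * y} -> chi 1 = 1 ->
  (forall x, `|chi x| <= 1) ->
  `|\sum_(y | y != 0) chi y * psi (inv_sum y)| <= (2 * m)%:R * r + m%:R.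
Proof.
move=> chiM chi1 chi_le; rewrite (bigID npole) /=.
apply: le_trans (ler_normD _ _) _; apply: lerD; first exact: inv_sum_weil.
apply: le_trans (ler_norm_sum _ _ _) _.
apply: (@le_trans _ _ (\sum_(y | (y != 0) && ~~ npole y) 1)).
  by apply: ler_sum => y _; rewrite normrM psi_norm mulr1.
by rewrite sumr_const ler_nat card_pole.
Qed.

Lemma inv_sum_full : `|\sum_y psi (inv_sum y)| <= (3 * m)%:R * r.
Proof.
have triv : `|\sum_y psi (inv_sum y)| <= r ^+ 2.
  rewrite r2 -cardF; apply: le_trans (ler_norm_sum _ _ _) _.
  by under eq_bigr => y _ do rewrite psi_norm; rewrite sumr_const.
(* For [q <= 9] one has [r <= 3] and the trivial bound [r ^+ 2] suffices. Otherwise [r >= 2], so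
   that the term at 0 and those at the poles satisfy [1 + m <= 2 m <= m r]. *)
have [q3|q4] := leqP (p ^ k) 9.
  apply: le_trans triv _; rewrite expr2 ler_pM2r //.
  apply: (@le_trans _ _ 3%:R); last by rewrite ler_nat leq_pmulr.
  by rewrite -(@ler_pXn2r _ 2) ?nnegrE ?(ltW r_gt0) // r2 -natrX ler_nat.
have r_ge2 : 2%:R <= r.
  by rewrite -(@ler_pXn2r _ 2) ?nnegrE ?(ltW r_gt0) // r2 -natrX ler_nat; lia.
rewrite (bigD1 0) //= -[3%N]/(1 + 2)%N mulnDl mul1n natrD mulrDl.
apply: le_trans (ler_normD _ _) _; rewrite psi_norm.
have n1 (x : F) : `|(1 : C)| <= 1 by rewrite normr1.
have chi_c : `|\sum_(y | y != 0) psi (inv_sum y)| <= (2 * m)%:R * r + m%:R.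
  under eq_bigr => y _ do rewrite -[psi _]mul1r.
  exact: (@inv_sum_character (fun=> 1) (fun x y => esym (mulr1 1)) erefl n1).
apply: le_trans (lerD (lexx 1) chi_c) _.
rewrite [_ + m%:R]addrC addrA lerD2r.
apply: (@le_trans _ _ (m%:R + m%:R)); first by rewrite lerD2r.
by rewrite -mulr2n -[m%:R *+ 2]mulr_natr ler_pM2l // (lt_le_trans ltr01 m1).
Qed.

(** Each of the [d] twisted sums is at most [2 m r + m]. Zero is not in the subgroup, so no extra
    term arises and [1 <= r] is enough to absorb the poles. *)
Lemma inv_sum_period (theta : F) (T : nat) : theta != 0 -> T.-primitive_root theta ->
  `|\sum_(n < T) psi (inv_sum (theta ^+ n))| <= (3 * m)%:R * r.
Proof.
move=> th0 thT; have [d [chi [d0 chiP sumchi]]] := subgroup_characters C th0 thT.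
have r1 : 1 <= r.
  rewrite -(@ler_pXn2r _ 2) ?nnegrE ?(ltW r_gt0) ?ler01 // r2 expr1n ler1n.
  by rewrite expn_gt0 (prime_gt0 (pcharf_prime pF)).
have dC : (0 : C) < d%:R by rewrite ltr0n.
have sumE : d%:R * (\sum_(n < T) psi (inv_sum (theta ^+ n))) =
    \sum_(l < d) \sum_(y | y != 0) chi l y * psi (inv_sum y).
  rewrite exchange_big /=.
  under [RHS]eq_bigr => y y0 do rewrite -mulr_suml sumchi //.
  rewrite mulr_sumr (bigID (fun y => y ^+ T == 1)) /= [X in _ = _ + X]big1 ?addr0; last first.
    by move=> y /andP[_ /negPf ->]; rewrite mul0r.
  rewrite -[RHS]big_filter (perm_big [seq theta ^+ (i : 'I_T) | i : 'I_T <- enum 'I_T]) /=; last first.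
    apply: uniq_perm; first exact: filter_uniq (index_enum_uniq F).
      rewrite map_inj_in_uniq ?enum_uniq // => i j _ _ /eqP.
      by rewrite (eq_prim_root_expr thT) !modn_small // => /eqP/val_inj.
    move=> y; rewrite mem_filter mem_index_enum andbT.
    apply/andP/mapP => [[_ /eqP /(prim_rootP thT) [i ->]]|[i _ ->]].
      by exists i; rewrite ?mem_enum.
    by rewrite expf_neq0 // exprAC (prim_expr_order thT) expr1n.
  rewrite big_map big_enum; apply: eq_bigr => n _ /=.
  by rewrite exprAC (prim_expr_order thT) expr1n eqxx.
rewrite -(ler_pM2l dC) -[X in X * `|_|]ger0_norm ?(ltW dC) // -normrM sumE.
apply: le_trans (ler_norm_sum _ _ _) _.
apply: (@le_trans _ _ (\sum_(l < d) (3 * m)%:R * r)); last first.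
  by rewrite sumr_const card_ord -[X in X <= _]mulr_natl.
apply: ler_sum => l _.
have [chiM chi1 chi_le] := chiP l.
apply: le_trans (inv_sum_character chiM chi1 chi_le) _.
rewrite -[3%N]/(1 + 2)%N mulnDl mul1n natrD mulrDl addrC lerD2r.
by rewrite ler_peMr // ler0n.
Qed.

End InversiveSums.

(** * Walsh coefficients of boxes *)

Lemma sum_ord_mul (V : nmodType) (p m : nat) (f : nat -> V) :
  \sum_(D < p * m) f D = \sum_(D < m) \sum_(c < p) f (p * D + c)%N.
Proof.
elim: m => [|m IH]; first by rewrite muln0 !big_ord0.
by rewrite mulnSr big_split_ord big_ord_recr /= IH.
Qed.

Section DigitPairing.
Variable p : nat.
Hypothesis p_gt0 : (0 < p)%N.

(** The exponent of a Walsh function, up to the enumeration of the frequencies [e]: digits of equal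
    rank are paired, least significant first. *)
Fixpoint digit_pair (k e D : nat) : nat :=
  if k is k'.+1 then ((e %% p) * (D %% p) + digit_pair k' (e %/ p) (D %/ p))%N else 0%N.

Arguments digit_pair : simpl never.

Let digit_pairE k e D : digit_pair k.+1 e D =
  ((e %% p) * (D %% p) + digit_pair k (e %/ p) (D %/ p))%N.
Proof. by []. Qed.

Definition of_digits (k : nat) (t : nat -> nat) : nat := (\sum_(j < k) t j * p ^ j)%N.

Lemma of_digitsS k t : of_digits k.+1 t = (p * of_digits k (t \o S) + t 0)%N.
Proof.
rewrite /of_digits big_ord_recl expn0 muln1 addnC big_distrr /=; congr (_ + _)%N.
by apply: eq_bigr => j _; rewrite expnS mulnCA.
Qed.

Lemma of_digits_lt k t : (forall j, (t j < p)%N) -> (of_digits k t < p ^ k)%N.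
Proof.
elim: k t => [|k IH] t lt; first by rewrite /of_digits big_ord0.
rewrite of_digitsS expnS; have := IH (t \o S) (fun j => lt j.+1).
rewrite -(leq_pmul2l p_gt0) mulnS; have := lt 0%N; lia.
Qed.

Let divmodE a c : (c < p)%N -> ((p * a + c) %/ p = a)%N /\ ((p * a + c) %% p = c)%N.
Proof.
by move=> lt; rewrite mulnC divnMDl // divn_small // addn0 modnMDl modn_small.
Qed.

Lemma digit_pair_digits k s t :
  (forall j, (s j < p)%N) -> (forall j, (t j < p)%N) ->
  digit_pair k (of_digits k s) (of_digits k t) = (\sum_(j < k) s j * t j)%N.
Proof.
elim: k s t => [|k IH] s t lts ltt; first by rewrite big_ord0.
rewrite !of_digitsS big_ord_recl digit_pairE.
have [-> ->] := divmodE (of_digits k (s \o S)) (lts 0%N).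
have [-> ->] := divmodE (of_digits k (t \o S)) (ltt 0%N).
by rewrite IH // => j; [apply: lts|apply: ltt].
Qed.

Lemma of_digits_inj k s t :
  (forall j, (s j < p)%N) -> (forall j, (t j < p)%N) ->
  of_digits k s = of_digits k t -> forall j, (j < k)%N -> s j = t j.
Proof.
elim: k s t => [//|k IH] s t lts ltt; rewrite !of_digitsS => e.
have [d1 m1] := divmodE (of_digits k (s \o S)) (lts 0%N).
have [d2 m2] := divmodE (of_digits k (t \o S)) (ltt 0%N).
case=> [|j] ltj; first by rewrite -m1 e m2.
have := congr1 (divn^~ p) e; rewrite /= d1 d2 => e'.
exact: (IH (s \o S) (t \o S) (fun j => lts j.+1) (fun j => ltt j.+1) e').
Qed.

Lemma digit_pairS k e D c d : (c < p)%N -> (d < p)%N ->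
  digit_pair k.+1 (p * e + c) (p * D + d) = (c * d + digit_pair k e D)%N.
Proof.
move=> ltc ltd; rewrite digit_pairE.
by have [-> ->] := divmodE e ltc; have [-> ->] := divmodE D ltd.
Qed.

Section WalshSum.
Variables (C : numClosedFieldType) (zeta : C) (g : nat -> C) (kappa : C).
Hypothesis zeta_prim : p.-primitive_root zeta.
Hypothesis g_bound : forall c m, (0 < c < p)%N -> (m <= p)%N ->
  `|\sum_(d < m) zeta ^+ (c * d)| <= g c.
Hypothesis kappaE : \sum_(c < p | (0 < c)%N) g c <= p%:R * kappa.

Lemma geometric_full c : (0 < c < p)%N -> \sum_(d < p) zeta ^+ (c * d) = 0.
Proof.
move=> /andP[c0 cp]; have zc1 : zeta ^+ c != 1.
  by rewrite -(prim_order_dvd zeta_prim) gtnNdvd.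
under eq_bigr => d _ do rewrite exprM.
apply/eqP; rewrite -[_ == 0]orFb -{1}(negPf zc1) -subr_eq0 -mulf_eq0 -subrX1.
by rewrite exprAC (prim_expr_order zeta_prim) expr1n subrr.
Qed.

(* The least significant digit is split off: if its frequency vanishes the sum
   is a convex combination of two shorter ones, otherwise complete blocks of
   digits cancel. *)
Lemma walsh_sum k m : (m <= p ^ k)%N ->
  \sum_(e < p ^ k) `|\sum_(D < m) zeta ^+ digit_pair k e D| <=
  (p ^ k)%:R * (1 + k%:R * kappa).
Proof.
elim: k m => [|k IH] m le_m.
  rewrite expn0 big_ord1 mul0r addr0 mulr1; apply: le_trans (ler_norm_sum _ _ _) _.
  under eq_bigr => D _ do rewrite normr1.
  by rewrite sumr_const card_ord ler_nat.
pose m' := (m %/ p)%N; pose r := (m %% p)%N.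
have mE : m = (p * m' + r)%N by rewrite mulnC -divn_eq.
have ltr : (r < p)%N by rewrite ltn_mod.
have le_m' : (m' <= p ^ k)%N.
  by rewrite -(leq_pmul2l p_gt0) -expnS (leq_trans _ le_m) // mE leq_addr.
have lt_m' : (0 < r)%N -> (m' < p ^ k)%N.
  by move=> r0; rewrite -(ltn_pmul2l p_gt0) -expnS (leq_trans _ le_m) // mE; lia.
pose G n e := \sum_(D < n) zeta ^+ digit_pair k e D.
have sumE e c : (c < p)%N -> \sum_(D < m) zeta ^+ digit_pair k.+1 (p * e + c) D =
    (\sum_(d < p) zeta ^+ (c * d)) * G m' e +
    (\sum_(d < r) zeta ^+ (c * d)) * zeta ^+ digit_pair k e m'.
  move=> ltc; rewrite mE big_split_ord /=.
  rewrite (sum_ord_mul p m' (fun D => zeta ^+ digit_pair k.+1 (p * e + c) D)).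
  congr (_ + _).
    rewrite mulr_sumr; apply: eq_bigr => D _; rewrite mulr_suml; apply: eq_bigr => d _.
    by rewrite digit_pairS // exprD.
  rewrite mulr_suml; apply: eq_bigr => d _.
  by rewrite digit_pairS ?exprD // (ltn_trans _ ltr).
have z1 i : `|zeta ^+ i| = 1.
  have zz : `|zeta| = 1.
    apply/eqP; rewrite -(@pexpr_eq1 _ _ p) // -normrX.
    by rewrite (prim_expr_order zeta_prim) normr1.
  by rewrite normrX zz expr1n.
(* The guard keeps [m'.+1] within the range of the induction hypothesis; for [r = 0] that term has
   weight zero anyway. *)
have bound0 e : `|\sum_(D < m) zeta ^+ digit_pair k.+1 (p * e) D| <=
    (p - r)%:R * `|G m' e| + r%:R * (if (0 < r)%N then `|G m'.+1 e| else 0).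
  have := sumE e 0%N p_gt0; rewrite addn0 => ->.
  under eq_bigr => d _ do rewrite mul0n expr0.
  under [X in _ + X * _]eq_bigr => d _ do rewrite mul0n expr0.
  rewrite !sumr_const !card_ord.
  have -> : p%:R * G m' e + r%:R * zeta ^+ digit_pair k e m' =
      (p - r)%:R * G m' e + r%:R * G m'.+1 e.
    by rewrite /G big_ord_recr /= natrB ?(ltnW ltr) //; ring.
  apply: le_trans (ler_normD _ _) _; rewrite !normrM !normr_nat lerD2l.
  by case: ifP => // /negbT; rewrite -eqn0Ngt => /eqP ->; rewrite !mul0r.
have bound1 e c : (0 < c < p)%N ->
    `|\sum_(D < m) zeta ^+ digit_pair k.+1 (p * e + c) D| <= g c.
  move=> cP; have /andP[_ ltc] := cP; rewrite sumE // geometric_full // mul0r add0r.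
  by rewrite normrM z1 mulr1 g_bound // ltnW.
rewrite expnS.
rewrite (sum_ord_mul p (p ^ k) (fun e => `|\sum_(D < m) zeta ^+ digit_pair k.+1 e D|)).
rewrite exchange_big (bigD1 (Ordinal p_gt0)) //=.
under eq_bigr => e _ do rewrite addn0.
have -> : (p * p ^ k)%:R * (1 + k.+1%:R * kappa) =
   p%:R * ((p ^ k)%:R * (1 + k%:R * kappa)) + (p ^ k)%:R * (p%:R * kappa).
  by rewrite natrM -natr1; ring.
apply: lerD.
  apply: (@le_trans _ _ (\sum_(e < p ^ k)
      ((p - r)%:R * `|G m' e| + r%:R * (if (0 < r)%N then `|G m'.+1 e| else 0)))).
    by apply: ler_sum => e _; apply: bound0.
  rewrite big_split /= -!mulr_sumr.
  have -> : p%:R = (p - r)%:R + r%:R :> C by rewrite -natrD subnK // ltnW.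
  rewrite mulrDl; apply: lerD; first by rewrite ler_wpM2l ?ler0n // IH.
  have [r0|] := ltnP 0 r; first by rewrite ler_wpM2l ?ler0n // IH // lt_m'.
  by rewrite leqn0 => /eqP ->; rewrite !mul0r.
apply: le_trans (_ : \sum_(c < p | (0 < c)%N) (p ^ k)%:R * g c <= _); last first.
  by rewrite -mulr_sumr ler_wpM2l ?ler0n.
rewrite (eq_bigl (fun c : 'I_p => (0 < c)%N)) => [|c]; last by rewrite -val_eqE /= lt0n.
apply: ler_sum => c c0; rewrite mulr_natl -[X in _ *+ X]card_ord -sumr_const.
by apply: ler_sum => e _; apply: bound1; rewrite c0 ltn_ord.
Qed.

End WalshSum.
End DigitPairing.

(** * Walsh expansion of boxes for digital points *)

Section DigitalFourier.
Variables (F : finFieldType) (C : numClosedFieldType) (p k : nat).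
Hypotheses (pF : p \in [pchar F]) (k_gt0 : (0 < k)%N) (cardF : #|F| = (p ^ k)%N).
Variables (zeta kappa : C) (g : nat -> C).
Hypothesis zeta_prim : p.-primitive_root zeta.
Hypothesis g_bound : forall c m, (0 < c < p)%N ->
  `|\sum_(d < m) zeta ^+ (c * d)| <= g c.
Hypothesis kappa_ge : \sum_(c < p | (0 < c)%N) g c <= p%:R * kappa.
(* Coordinates are listed from the least significant one. *)
Variables (t : F -> nat -> nat) (beta : nat -> F).
Hypothesis t_lt : forall z j, (t z j < p)%N.
Hypothesis tE : forall z, z = \sum_(j < k) (t z j)%:R * beta j.
Local Notation q := (p ^ k)%N.
Local Notation psi := (add_char p k zeta).
Let p_prime : prime p := pcharf_prime pF.
Let p_gt0 : (0 < p)%N := prime_gt0 p_prime.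
Let q_gt0 : (0 : C) < q%:R. Proof. by rewrite ltr0n expn_gt0 p_gt0. Qed.

Definition digit_num (z : F) : nat := of_digits p k (t z).
(** The coordinates of [h] in the basis dual to [beta] for the trace form. Through them
    [psi (h * z)] becomes a Walsh function of the digits of [z], whatever the basis. *)
Definition freq (h : F) (j : nat) : nat := plog p (abs_trace p k (h * beta j)).
Definition freq_num (h : F) : nat := of_digits p k (freq h).

Let abs_trace_sum (I : Type) (r : seq I) (f : I -> F) :
  abs_trace p k (\sum_(i <- r) f i) = \sum_(i <- r) abs_trace p k (f i).
Proof. by apply: big_morph; [exact: abs_traceD|exact: abs_trace0]. Qed.

Let abs_trace_natM n (x : F) : abs_trace p k (n%:R * x) = n%:R * abs_trace p k x.
Proof.
elim: n => [|n IH]; first by rewrite !mul0r abs_trace0.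
by rewrite -natr1 !mulrDl !mul1r abs_traceD // IH.
Qed.

Lemma freqE h j : (freq h j < p)%N /\ (freq h j)%:R = abs_trace p k (h * beta j).
Proof. by apply: plogP => //; apply: abs_traceX. Qed.

Let abs_traceE h z : abs_trace p k (h * z) = (\sum_(j < k) freq h j * t z j)%:R.
Proof.
rewrite {1}[z]tE mulr_sumr abs_trace_sum natr_sum; apply: eq_bigr => j _.
by rewrite mulrCA abs_trace_natM natrM (freqE h j).2 mulrC.
Qed.

Lemma add_char_pair h z : psi (h * z) = zeta ^+ digit_pair p k (freq_num h) (digit_num z).
Proof.
rewrite digit_pair_digits //; last by move=> j; case: (freqE h j).
by apply: (add_char_natr pF k_gt0 cardF zeta_prim); rewrite abs_traceE.
Qed.

Lemma digit_num_lt z : (digit_num z < q)%N. Proof. exact: of_digits_lt. Qed.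

Lemma freq_num_lt h : (freq_num h < q)%N.
Proof. by apply: of_digits_lt => // j; case: (freqE h j). Qed.

Lemma digit_num_inj : injective digit_num.
Proof.
move=> x y xy; rewrite [x]tE [y]tE; apply: eq_bigr => j _.
by rewrite (of_digits_inj p_gt0 (t_lt x) (t_lt y) xy).
Qed.

(** Nondegeneracy of the trace form: equal frequencies make the trace of [(x - y) * z] vanish for
    every [z], while [(x - y) * z] can take a value [w] of nonzero trace. *)
Lemma freq_num_inj : injective freq_num.
Proof.
move=> x y xy; apply/eqP; rewrite -subr_eq0; apply/negPn/negP => d0.
have [w w0] := abs_trace_neq0 pF k_gt0 cardF.
have tr z : abs_trace p k (x * z) = abs_trace p k (y * z).
  rewrite !abs_traceE; congr (_%:R); apply: eq_bigr => j _; congr (_ * _)%N.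
  exact: (of_digits_inj p_gt0 (fun i => (freqE x i).1) (fun i => (freqE y i).1) xy).
have := abs_traceD k pF ((x - y) * (w / (x - y))) (y * (w / (x - y))).
have e : (x - y) * (w / (x - y)) = w by rewrite mulrC divfK.
rewrite -mulrDl subrK tr e => /eqP; rewrite eq_sym -subr_eq0 addrK.
by rewrite (negPf w0).
Qed.

Lemma sum_num (V : nmodType) (num : F -> nat) (f : nat -> V) : injective num ->
  (forall z, (num z < q)%N) -> \sum_z f (num z) = \sum_(e < q) f e.
Proof.
move=> num_inj num_lt; pose h z : 'I_q := Ordinal (num_lt z).
have h_inj : injective h by move=> x y /(congr1 val) /num_inj.
have h_bij : bijective h by apply: inj_card_bij => //; rewrite card_ord cardF.
by rewrite [RHS](reindex h) //; apply: onW_bij.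
Qed.

Lemma add_char_orthogonality (w : F) : \sum_h psi (h * w) = if w == 0 then q%:R else 0.
Proof.
have [->|w0] := eqVneq w 0.
  rewrite -cardF -sumr_const; apply: eq_bigr => h _.
  by rewrite mulr0 (add_char0 pF k_gt0 cardF zeta_prim).
have [y y1] := add_char_neq1 pF k_gt0 cardF zeta_prim.
have : \sum_h psi (h * w) = \sum_h psi (h * w) * psi y.
  rewrite {1}(reindex_inj (addIr (y / w))) /=; apply: eq_bigr => h _.
  by rewrite mulrDl divfK // (add_charD pF k_gt0 cardF zeta_prim).
rewrite -mulr_suml => /eqP; rewrite -subr_eq0 -{1}[\sum_h _]mulr1 -mulrBr mulf_eq0.
by rewrite subr_eq0 [1 == _]eq_sym (negPf y1) orbF => /eqP.
Qed.

Definition walsh_coef (m : nat) (h : F) : C :=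
  q%:R^-1 * \sum_(y | (digit_num y < m)%N) psi (- h * y).

Lemma walsh_coefE m z :
  (digit_num z < m)%N%:R = \sum_h walsh_coef m h * psi (h * z).
Proof.
under eq_bigr => h _ do rewrite -mulrA mulr_suml.
rewrite -mulr_sumr exchange_big /=.
under eq_bigr => y _ do
  under eq_bigr => h _ do rewrite -(add_charD pF k_gt0 cardF zeta_prim) mulNr addrC -mulrBr.
under eq_bigr => y _ do rewrite add_char_orthogonality subr_eq0.
rewrite -big_mkcondr /=; case: ltnP => zm.
  rewrite (big_pred1 z) => [|y]; first by rewrite mulVf ?gt_eqF.
  by apply/andP/eqP => [[_ /eqP ->//]|->]; rewrite zm eqxx.
rewrite big_pred0 ?mulr0 // => y; apply/andP => -[ym /eqP zy].
by move: zm; rewrite zy leqNgt ym.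
Qed.

Lemma walsh_coef0 m : (m <= q)%N -> walsh_coef m 0 = m%:R / q%:R.
Proof.
move=> le_m; rewrite mulrC; congr (_ * _).
under eq_bigr => y _ do rewrite oppr0 mul0r (add_char0 pF k_gt0 cardF zeta_prim).
rewrite big_mkcond (sum_num (fun e => if (e < m)%N then 1 else 0) digit_num_inj digit_num_lt).
rewrite -big_mkcond /= -(big_ord_widen q (fun=> 1)) // sumr_const card_ord //.
Qed.

Lemma walsh_coef_full h : h != 0 -> walsh_coef q h = 0.
Proof.
move=> h0; rewrite /walsh_coef.
rewrite (eq_bigl predT) => [|y]; last by rewrite digit_num_lt.
under eq_bigr => y _ do rewrite mulrC.
by rewrite add_char_orthogonality oppr_eq0 (negPf h0) mulr0.
Qed.

(** Both [freq_num] and [digit_num] enumerate [F] by the integers below [q], which turns the sum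
    into that of [walsh_sum]. *)
Lemma walsh_coef_sum m : (m <= q)%N ->
  \sum_h `|walsh_coef m h| <= 1 + k%:R * kappa.
Proof.
move=> le_m; under eq_bigr => h _ do rewrite normrM [`|q%:R^-1|]ger0_norm ?invr_ge0 ?ler0n //.
rewrite -mulr_sumr mulrC ler_pdivrMr // mulrC.
rewrite (reindex_inj (@oppr_inj F)) /=.
under eq_bigr => h _ do rewrite opprK.
under eq_bigr => h _ do under eq_bigr => y _ do rewrite add_char_pair.
rewrite (eq_bigr (fun h => `|\sum_(D < m) zeta ^+ digit_pair p k (freq_num h) D|)); last first.
  move=> h _; congr `|_|; rewrite big_mkcond /=.
  rewrite (sum_num (fun e => if (e < m)%N then zeta ^+ digit_pair p k (freq_num h) e else 0)
    digit_num_inj digit_num_lt).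
  by rewrite -big_mkcond /= -(big_ord_widen q (fun e => zeta ^+ digit_pair p k (freq_num h) e)).
rewrite (sum_num (fun e => `|\sum_(D < m) zeta ^+ digit_pair p k e D|) freq_num_inj freq_num_lt).
apply: (walsh_sum p_gt0 zeta_prim _ kappa_ge le_m) => c m' cp _.
exact: g_bound.
Qed.

(** The indicator of the box is expanded exactly, with no truncation error. The zero frequency gives
    the volume term, and frequencies not supported in [u] have coefficient zero since the box is
    full there. For the rest, the sum of the absolute coefficients factors over the coordinates. *)
Lemma box_count_bound (J : finType) (s : nat) (z : J -> 'I_s -> F) (u : {set 'I_s})
    (m : 'I_s -> nat) (B : C) :
  (forall i, (m i <= q)%N) -> (forall i, i \notin u -> m i = q) ->
  (forall f : {ffun 'I_s -> F}, f != [ffun=> 0] -> (forall i, i \notin u -> f i = 0) ->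
     `|\sum_n psi (\sum_i f i * z n i)| <= B) -> 0 <= B ->
  `|#|[set n | [forall i, (digit_num (z n i) < m i)%N]]|%:R -
     #|J|%:R * \prod_i ((m i)%:R / q%:R)| <= (1 + k%:R * kappa) ^+ #|u| * B.
Proof.
move=> le_m m_u hB B0.
pose c (f : {ffun 'I_s -> F}) := \prod_i walsh_coef (m i) (f i).
pose f0 : {ffun 'I_s -> F} := [ffun=> 0].
have psiS (r : seq 'I_s) (f : 'I_s -> F) : psi (\sum_(i <- r) f i) = \prod_(i <- r) psi (f i).
  apply: big_morph; first exact: (add_charD pF k_gt0 cardF zeta_prim).
  exact: (add_char0 pF k_gt0 cardF zeta_prim).
have cntE : #|[set n | [forall i, (digit_num (z n i) < m i)%N]]|%:R =
    \sum_f c f * \sum_n psi (\sum_i f i * z n i).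
  under [RHS]eq_bigr => f _ do rewrite mulr_sumr.
  rewrite exchange_big /= -sum1_card natr_sum big_mkcond /=; apply: eq_bigr => n _.
  transitivity (\prod_i ((digit_num (z n i) < m i)%N%:R : C)).
    rewrite inE; have [/forallP lt|] := boolP [forall i, (digit_num (z n i) < m i)%N].
      by rewrite big1 // => i _; rewrite lt.
    by rewrite negb_forall; case/existsP => i /negPf ge; rewrite (bigD1 i) //= ge mul0r.
  under eq_bigr => i _ do rewrite walsh_coefE.
  rewrite (bigA_distr_bigA (fun i h => walsh_coef (m i) h * psi (h * z n i))) /=.
  by apply: eq_bigr => f _; rewrite big_split /= psiS.
have c0E : c f0 * \sum_n psi (\sum_i f0 i * z n i) = #|J|%:R * \prod_i ((m i)%:R / q%:R).
  rewrite mulrC; congr (_ * _).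
    rewrite -sumr_const; apply: eq_bigr => n _; rewrite big1 => [|i _].
      exact: (add_char0 pF k_gt0 cardF zeta_prim).
    by rewrite ffunE mul0r.
  by apply: eq_bigr => i _; rewrite ffunE walsh_coef0.
rewrite cntE (bigD1 f0) //= c0E addrAC subrr add0r.
have normc f : `|c f| = \prod_i `|walsh_coef (m i) (f i)| by rewrite normr_prod.
apply: (@le_trans _ _ (\sum_(f | f != f0) `|c f| * B)).
  apply: le_trans (ler_norm_sum _ _ _) _; apply: ler_sum => f ff0; rewrite normrM.
  have [/forallP fu|] := boolP [forall i, (i \notin u) ==> (f i == 0)].
    by rewrite ler_wpM2l // hB // => i iu; have /implyP/(_ iu)/eqP := fu i.
  rewrite negb_forall; case/existsP => i; rewrite negb_imply => /andP[iu fi].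
  suff -> : c f = 0 by rewrite normr0 !mul0r.
  by rewrite /c (bigD1 i) //= m_u // walsh_coef_full // mul0r.
rewrite -mulr_suml ler_wpM2r //.
apply: (@le_trans _ _ (\sum_f `|c f|)).
  by rewrite [leRHS](bigD1 f0) //= lerDr.
under eq_bigr => f _ do rewrite normc.
rewrite -(bigA_distr_bigA (fun i h => `|walsh_coef (m i) h|)) /=.
rewrite (bigID (mem u)) /= -[leRHS]mulr1; apply: ler_pM.
- by apply: prodr_ge0 => i _; apply: sumr_ge0.
- by apply: prodr_ge0 => i _; apply: sumr_ge0.
- rewrite -prodr_const; apply: ler_prod => i _; rewrite sumr_ge0 //=.
  exact: walsh_coef_sum.
rewrite big1 // => i iu; rewrite m_u // (bigD1 0) //= big1 => [|h h0].
  by rewrite walsh_coef0 // divff ?gt_eqF // normr1 addr0.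
by rewrite walsh_coef_full // normr0.
Qed.

End DigitalFourier.

(** * Cosecant sums *)

Section TrigBounds.
Variable R : realType.
Implicit Types x t u : R.

(** Applied repeatedly from [cos <= 1], this yields the alternating Taylor bounds of sine and
    cosine. *)
Lemma ge0_of_derive (f df : R -> R) : (forall x, is_derive x 1 f (df x)) ->
  (forall x, 0 <= x -> 0 <= df x) -> 0 <= f 0 -> forall x, 0 <= x -> 0 <= f x.
Proof.
move=> fdf df0 f0 x; rewrite le_eqVlt => /orP[/eqP <- //|x0].
have cf : {within `[0, x], continuous f}%classic.
  have df1 y : derivable f y 1 by apply: ex_derive.
  by apply: continuous_subspaceT => y; apply/differentiable_continuous/derivable1_diffP.
have [c] := @MVT R f df 0 x x0 (fun y _ => fdf y) cf.
rewrite in_itv /= subr0 => /andP[c0 _] fE.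
by rewrite -(subrK (f 0) (f x)) fE addr_ge0 // mulr_ge0 ?df0 // ltW.
Qed.

Lemma sin_le x : 0 <= x -> sin x <= x.
Proof.
move=> x0; rewrite -subr_ge0.
apply: (@ge0_of_derive (fun y => y - sin y) (fun y => 1 - cos y)) => //.
by rewrite sin0 subr0.
Qed.

Lemma cos_ge_taylor x : 0 <= x -> 1 - x ^+ 2 / 2 <= cos x.
Proof.
move=> x0; rewrite -subr_ge0.
apply: (@ge0_of_derive (fun y => cos y - (1 - y ^+ 2 / 2)) (fun y => y - sin y)).
- move=> y; apply: is_derive_eq; rewrite !scaler1 /GRing.scale /=. lra.
- by move=> y y0; rewrite subr_ge0 sin_le.
- by rewrite cos0 expr0n /= mul0r subr0 subrr.
- by [].
Qed.

Lemma sin_ge_taylor x : 0 <= x -> x - x ^+ 3 / 6 <= sin x.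
Proof.
move=> x0; rewrite -subr_ge0.
apply: (@ge0_of_derive (fun y => sin y - (y - y ^+ 3 / 6))
  (fun y => cos y - (1 - y ^+ 2 / 2))).
- move=> y; apply: is_derive_eq; rewrite !scaler1 /GRing.scale /=. lra.
- by move=> y y0; rewrite subr_ge0 cos_ge_taylor.
- by rewrite sin0 expr0n /= mul0r subr0 subrr.
- by [].
Qed.

Lemma cos_le_taylor x : 0 <= x -> cos x <= 1 - x ^+ 2 / 2 + x ^+ 4 / 24.
Proof.
move=> x0; rewrite -subr_ge0.
apply: (@ge0_of_derive (fun y => (1 - y ^+ 2 / 2 + y ^+ 4 / 24) - cos y)
  (fun y => sin y - (y - y ^+ 3 / 6))).
- move=> y; apply: is_derive_eq; rewrite !scaler1 /GRing.scale /=. lra.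
- by move=> y y0; rewrite subr_ge0 sin_ge_taylor.
- by rewrite cos0 !expr0n /= !mul0r; lra.
- by [].
Qed.

(** By its Taylor bound [cos (9 / 5)] is negative, whereas [pi > 18 / 5] would place [9 / 5] below
    [pi / 2]. *)
Lemma pi_le : (pi : R) <= 18 / 5.
Proof.
rewrite leNgt; apply/negP => ltpi.
have : 0 < cos (9 / 5 : R) by apply: cos_gt0_pihalf; lra.
have := @cos_le_taylor (9 / 5) ltac:(lra); lra.
Qed.

Lemma csc_le t : 0 < t -> t <= pi / 2 -> (sin t)^-1 <= t^-1 + 37 / 100 * t.
Proof.
move=> t0 tpi; have tpi' : t <= 9 / 5 by have := pi_le; lra.
have st : 0 < sin t by apply: sin_gt0_pi; have := pi_gt0 R; lra.
have s1 := sin_ge_taylor (ltW t0).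
rewrite -[X in X <= _]mul1r ler_pdivrMr //.
have c0 : 0 <= t^-1 + 37 / 100 * t.
  by rewrite addr_ge0 ?invr_ge0 ?mulr_ge0 ?(ltW t0) //; lra.
apply: le_trans (ler_wpM2l c0 s1).
(* The constant [37 / 100] is large enough for [37 / 100 - 1 / 6 - 37 / 600 * t ^+ 2] to be
   nonnegative up to [t = 9 / 5], and small enough for the [2 / 5] in [csc_sum_odd]. *)
have -> : (t^-1 + 37 / 100 * t) * (t - t ^+ 3 / 6) =
  1 + t ^+ 2 * (37 / 100 - 1 / 6 - 37 / 600 * t ^+ 2) by field; rewrite gt_eqF.
have t2 : t ^+ 2 <= 81 / 25 by nra.
rewrite lerDl; apply: mulr_ge0; first exact: sqr_ge0.
lra.
Qed.

(** A form of [tanh u <= u]; for [u < 1] it says [2 u <= ln ((1 + u) / (1 - u))]. *)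
Lemma exp_ratio u : 0 <= u -> (1 - u) * expR u <= (1 + u) * expR (- u).
Proof.
move=> u0; rewrite -subr_ge0.
apply: (@ge0_of_derive (fun y => (1 + y) * expR (- y) - (1 - y) * expR y)
  (fun y => y * (expR y - expR (- y)))).
- move=> y; apply: is_derive_eq; rewrite /GRing.scale /=; lra.
- by move=> y y0; rewrite mulr_ge0 // subr_ge0 ler_expR; lra.
- by rewrite oppr0 !addr0 subrr.
- by [].
Qed.

(** The increment is [exp_ratio] at [u = 1 / (2 n + 2)], as [(1 + u) / (1 - u) = (2 n + 3) / (2 n +
    1)]. In the application [2 n + 1] is the prime itself, so the logarithm comes without an
    additive constant. *)
Lemma harmonic_le n : \sum_(i < n) (i.+1%:R : R)^-1 <= ln n.*2.+1%:R.
Proof.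
elim: n => [|n IH]; first by rewrite big_ord0 ln1.
rewrite big_ord_recr /=; apply: le_trans (lerD IH (lexx _)) _.
have n0 : (0 : R) < n.*2.+1%:R by rewrite ltr0n.
have n0' : (0 : R) < n.+1.*2.+1%:R by rewrite ltr0n.
rewrite -lerBrDl -ln_div ?posrE // -ler_expR lnK ?posrE ?divr_gt0 //.
pose u : R := (n.+1.*2)%:R^-1.
have m0 : (0 : R) < n.+1.*2%:R by rewrite ltr0n.
have u0 : 0 <= u by rewrite invr_ge0 ltW.
have -> : (n.+1%:R : R)^-1 = u + u by rewrite /u -muln2 natrM invfM -splitr.
have := exp_ratio u0; rewrite expRN expRD => e.
have eu := expR_gt0 u.
have {}e : (1 - u) * (expR u * expR u) <= 1 + u.
  by rewrite mulrA -ler_pdivlMr.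
rewrite ler_pdivlMr // mulrC.
have uN : u * n.+1.*2%:R = 1 by rewrite mulVf // gt_eqF.
have -> : n.+1.*2.+1%:R = (1 + u) * n.+1.*2%:R :> R by rewrite mulrDl mul1r uN natr1.
have -> : n.*2.+1%:R = (1 - u) * n.+1.*2%:R :> R.
  by rewrite mulrBl mul1r uN doubleS -[n.*2.+2%:R]natr1 addrK.
by rewrite mulrAC ler_wpM2r // ltW.
Qed.
End TrigBounds.

Local Open Scope complex_scope.

Section CosecantSum.
Variable R : realType.

Definition csc (p c : nat) : R := (sin (pi * c%:R / p%:R))^-1.

Lemma csc_rev p c : (c < p)%N -> csc p (p - c) = csc p c.
Proof.
move=> ltc; have p0 : (p%:R : R) != 0 by rewrite pnatr_eq0; case: p ltc.
rewrite /csc natrB ?(ltnW ltc) // mulrBr mulrBl mulfK //.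
by rewrite sinB sinpi cospi mul0r sub0r mulN1r opprK.
Qed.

Lemma csc_half_le n c : (0 < c <= n)%N ->
  csc n.*2.+1 c <= (n.*2.+1%:R / pi) / c%:R + 37 / 100 * pi / n.*2.+1%:R * c%:R.
Proof.
move=> /andP[c0 cn]; set p := n.*2.+1.
have pi0 := pi_gt0 R.
have p0 : (0 : R) < p%:R by rewrite ltr0n.
have c0' : (0 : R) < c%:R by rewrite ltr0n.
have t0 : 0 < pi * c%:R / p%:R :> R by rewrite divr_gt0 ?mulr_gt0.
apply: le_trans (csc_le t0 _) _.
  rewrite ler_pdivrMr // mulrAC -mulrA ler_wpM2l ?(ltW pi0) // ler_pdivlMr //.
  by rewrite -natrM ler_nat /p; lia.
rewrite {t0} le_eqVlt; apply/orP; left; apply/eqP.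
move: (p%:R : R) p0 (c%:R : R) c0' (pi : R) pi0 => P P0 c' c'0 w w0; field.
by rewrite !gt_eqF.
Qed.

(** The symmetry between [c] and [p - c] folds the sum onto arguments below [pi / 2]. The terms in
    [1 / c] give the logarithm; the linear ones give [37 / 400 * pi * (p - 1 / p)], at most
    [333 / 1000 * p] by [pi_le]. *)
Lemma csc_sum_odd n :
  \sum_(c < n.*2.+1 | (0 < c)%N) csc n.*2.+1 c <=
  n.*2.+1%:R * (2 / pi * ln n.*2.+1%:R + 2 / 5).
Proof.
set p := n.*2.+1; have pi0 := pi_gt0 R; have pile := pi_le R.
have p0 : (0 : R) < p%:R by rewrite ltr0n.
have -> : \sum_(c < p | (0 < c)%N) csc p c = \sum_(i < n) (csc p i.+1 *+ 2).
  rewrite big_mkcond big_ord_recl /= add0r -addnn big_split_ord /=.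
  rewrite [X in _ + X](reindex_inj rev_ord_inj) /= -big_split; apply: eq_bigr => i _ /=.
  rewrite mulr2n; congr (_ + _); rewrite /bump /= -[RHS]csc_rev; last first.
    by rewrite /p; have := ltn_ord i; lia.
  by congr (csc p _); rewrite /p; have := ltn_ord i; lia.
apply: (@le_trans _ _ (\sum_(i < n) ((p%:R / pi) * (i.+1%:R)^-1 +
    37 / 100 * pi / p%:R * i.+1%:R) *+ 2)).
  apply: ler_sum => i _; rewrite lerMn2r /=; apply: csc_half_le.
  exact: ltn_ord.
rewrite sumrMnl big_split /= -!mulr_sumr.
have hn := harmonic_le R n.
have sn : \sum_(i < n) (i.+1%:R : R) = n%:R * n.+1%:R / 2.
  elim: (n) => [|m IH]; first by rewrite big_ord0 !mul0r.
  by rewrite big_ord_recr /= IH -!natr1; field.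
rewrite sn.
have pn : p%:R = 2 * n%:R + 1 :> R by rewrite /p -muln2 -natr1 natrM mulrC.
move: hn; rewrite -/p; set l := ln _; set S := \sum_(i < n) _ => hn.
rewrite -(natr1 n); move: pn pi0 pile p0; move: (pi : R) (p%:R : R) => w P pn w0 wle P0.
have -> : n%:R = (P - 1) / 2 by rewrite pn; field.
have hS : P / w * S <= P / w * l by rewrite ler_wpM2l // divr_ge0 // ltW.
have e1 : P * (2 / w * l + 2 / 5) = P / w * l *+ 2 + P * (2 / 5).
  by rewrite -mulr_natl; field; rewrite gt_eqF.
have e2 : 37 / 100 * w / P * ((P - 1) / 2 * ((P - 1) / 2 + 1) / 2) =
    37 / 800 * w * (P - P^-1).
  by field; rewrite gt_eqF.
have Pi0 : 0 < P^-1 by rewrite invr_gt0.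
have wP : w * P <= 18 / 5 * P by rewrite ler_wpM2r // ltW.
have wPi : 0 < w * P^-1 by rewrite mulr_gt0.
rewrite e1 e2 mulrnDl lerD //; first by rewrite lerMn2r.
by rewrite mulrBr -!mulrA -mulr_natl; lra.
Qed.

(* kappa p bounds the mean of the cosecants of pi c / p, 0 < c < p. *)
Definition kappa (p : nat) : R := if p == 2 then 1 / 2 else 2 / pi * ln p%:R + 2 / 5.

Lemma csc_sum_le p : prime p -> \sum_(c < p | (0 < c)%N) csc p c <= p%:R * kappa p.
Proof.
move=> pp; rewrite /kappa; case: eqP => [->|p2].
  rewrite big_mkcond !big_ord_recl big_ord0 /= /csc mulr1 sin_pihalf invr1; lra.
have [] := even_prime pp => // op.
by rewrite -[p]odd_double_half op /= csc_sum_odd.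
Qed.

(** For odd [p], [1 + k * kappa p <= k * (1 + kappa p)] since [k >= 1], and [7 / 5 = 1 + 2 / 5]. For
    [p = 2] the two sides are equal. *)
Lemma kappa_Tfun p k r : prime p -> (0 < k)%N -> (1 + k%:R * kappa p) ^+ r <=
  (if p == 2 then (k%:R / 2 + 1) ^+ r
   else (2 / pi * ln p%:R + 7 / 5) ^+ r * k%:R ^+ r).
Proof.
move=> pp k0; have k1 : (1 : R) <= k%:R by rewrite ler1n.
rewrite /kappa; case: eqP => _; first by rewrite addrC mul1r.
have l0 : 0 <= ln p%:R :> R by rewrite ln_ge0 // ler1n prime_gt0.
have a0 : 0 <= 2 / pi * ln p%:R :> R by rewrite mulr_ge0 // divr_ge0 ?pi_ge0.
rewrite -exprMn; move: a0; set a := _ * ln _ => a0.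
have ka : 0 <= k%:R * a by rewrite mulr_ge0.
have e1 : (a + 7 / 5) * k%:R = k%:R * a + k%:R * (7 / 5) by ring.
rewrite mulrDr e1; apply: lerXn2r; rewrite ?nnegrE; lra.
Qed.

End CosecantSum.

(** * The complex root of unity and its geometric sums *)

Section RootOfUnity.
Variables (R : realType) (p : nat).
Hypothesis p_prime : prime p.

Definition cis (t : R) : R[i] := cos t +i* sin t.

Lemma cisD s t : cis (s + t) = cis s * cis t.
Proof. by apply/eqP; rewrite eq_complex /= cosD sinD eqxx addrC mulrC [sin s * _]mulrC eqxx. Qed.

Lemma cis0 : cis 0 = 1. Proof. by rewrite /cis cos0 sin0. Qed.

Lemma cis_natM t n : cis (t * n%:R) = cis t ^+ n.
Proof.
elim: n => [|n IH]; first by rewrite mulr0 cis0.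
by rewrite -natr1 mulrDr mulr1 cisD IH exprSr.
Qed.

Lemma norm_1subcis t : 0 <= sin t -> `|1 - cis (t *+ 2)| = (sin t *+ 2)%:C.
Proof.
move=> s0; rewrite normc_def /= cos_mulr2n sin_mulr2n.
have -> : (1 - (cos t ^+ 2 *+ 2 - 1)) ^+ 2 + (0 - cos t * sin t *+ 2) ^+ 2 =
   (sin t *+ 2) ^+ 2.
  have := cos2Dsin2 t; move: (cos t) (sin t) => c s e; rewrite !mulr2n.
  transitivity (4 * (1 - c ^+ 2) ^+ 2 + 4 * c ^+ 2 * s ^+ 2); first by ring.
  by have -> : c ^+ 2 = 1 - s ^+ 2 by [rewrite -e addrK]; ring.
by rewrite sqrtr_sqr ger0_norm // mulrn_wge0.
Qed.

Lemma norm_cis t : `|cis t| = 1.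
Proof. by rewrite normc_def /= cos2Dsin2 sqrtr1. Qed.

Definition zeta_p : R[i] := cis (pi / p%:R *+ 2).

Let p_neq0 : (p%:R : R) != 0.
Proof. by rewrite pnatr_eq0 -lt0n prime_gt0. Qed.

Let sin_pos c : (0 < c < p)%N -> 0 < sin (pi * c%:R / p%:R : R).
Proof.
move=> /andP[c0 cp]; have p0 : (0 : R) < p%:R by rewrite ltr0n prime_gt0.
apply: sin_gt0_pi; apply/andP; split.
  by rewrite divr_gt0 // mulr_gt0 ?pi_gt0 // ltr0n.
by rewrite ltr_pdivrMr // ltr_pM2l ?pi_gt0 // ltr_nat.
Qed.

Lemma norm_1subzeta c : (0 < c < p)%N -> `|1 - zeta_p ^+ c| = (2 / csc R p c)%:C.
Proof.
move=> cp; rewrite /zeta_p -cis_natM.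
have -> : pi / p%:R *+ 2 * c%:R = (pi * c%:R / p%:R) *+ 2 :> R.
  by rewrite mulrnAl mulrAC.
by rewrite norm_1subcis ?(ltW (sin_pos cp)) // /csc invrK mulr_natl.
Qed.

Lemma zeta_prim : p.-primitive_root zeta_p.
Proof.
have zp : zeta_p ^+ p = 1.
  by rewrite -cis_natM mulrnAl divfK // /cis cos2pi sin2pi.
have [m mprim mp] := prim_order_exists (prime_gt0 p_prime) zp.
have /primeP[_ /(_ m mp)/orP[/eqP m1|/eqP <- //]] := p_prime.
have /eqP := prim_expr_order mprim; rewrite m1 expr1 => /eqP z1.
have cp : (0 < 1 < p)%N by rewrite prime_gt1.
have := norm_1subzeta cp; rewrite expr1 z1 subrr normr0 => /eqP.
rewrite eq_sym -(rmorph0 (real_complex R)) (inj_eq (@complexI R)) /csc invrK.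
by rewrite mulf_eq0 (gt_eqF (sin_pos cp)) pnatr_eq0.
Qed.

(** The closed form has a numerator of modulus at most 2 and a denominator of modulus
    [2 sin (pi c / p)]; the bound is therefore uniform in [m]. *)
Lemma zeta_geometric c m : (0 < c < p)%N ->
  `|\sum_(d < m) zeta_p ^+ (c * d)| <= (csc R p c)%:C.
Proof.
move=> cp; have s0 := sin_pos cp.
have n0 : 0 < `|1 - zeta_p ^+ c|.
  by rewrite norm_1subzeta // (_ : 0 = 0%:C) // ltcR divr_gt0 // invr_gt0.
rewrite -(ler_pM2l n0) -normrM.
have -> : (1 - zeta_p ^+ c) * (\sum_(d < m) zeta_p ^+ (c * d)) = 1 - zeta_p ^+ (c * m).
  under eq_bigr => d _ do rewrite exprM.
  by rewrite -[1 - _ in LHS]opprB mulNr -subrX1 opprB exprM.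
apply: le_trans (ler_normB _ _) _.
rewrite normr1 -cis_natM norm_cis norm_1subzeta // -rmorphM /= divfK ?invr_eq0 ?gt_eqF //.
by rewrite -[1 + 1]/(2%:R) -(rmorph_nat (real_complex R)).
Qed.

Lemma archi_complex (x : R[i]) : exists n : nat, `|x| <= n%:R.
Proof.
rewrite normc_def; set y := Num.sqrt _.
exists (Num.bound y); rewrite -(rmorph_nat (real_complex R)) lecR ltW //.
by apply: archi_boundP; exact: sqrtr_ge0.
Qed.

End RootOfUnity.

(** * Digital point sets *)

Lemma prod_diff_le (R : realFieldType) (I : finType) (x y : I -> R) :
  (forall i, 0 <= y i <= x i) -> (forall i, x i <= 1) ->
  0 <= \prod_i x i - \prod_i y i <= \sum_i (x i - y i).
Proof.
move=> yx x1; suff [_ _ ? ?] : [/\ 0 <= \prod_i y i, \prod_i x i <= 1,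
    0 <= \prod_i x i - \prod_i y i & \prod_i x i - \prod_i y i <= \sum_i (x i - y i)].
  by apply/andP.
elim/big_rec3: _ => [|i S X Y _ [Y0 X1 d0 dS]]; first by rewrite subrr; split.
have /andP[yi0 yxi] := yx i; have xi1 := x1 i; split; first exact: mulr_ge0.
- by apply: mulr_ile1 => //; lra.
- by rewrite subr_ge0 ler_pM //; lra.
have -> : x i * X - y i * Y = (x i - y i) * X + y i * (X - Y) by ring.
apply: lerD; first by rewrite ler_piMr // subr_ge0.
by apply: le_trans dS; rewrite ler_piMl //; lra.
Qed.

(** Digital points have coordinates in [q^-1] times the integers, so a side can be enlarged to the
    next grid value without changing the points it contains. The volume loses at most [1 / q] per
    coordinate. *)
Lemma round_up (R : realType) (q : nat) (a : R) : (0 < q)%N -> 0 <= a <= 1 ->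
  exists m : nat, [/\ (m <= q)%N, forall D, (D%:R / q%:R < a) = (D < m)%N,
    a <= m%:R / q%:R <= a + q%:R^-1 & a = 1 -> m = q].
Proof.
move=> q0 /andP[a0 a1]; have q0' : (0 : R) < q%:R by rewrite ltr0n.
have ex : exists n : nat, a * q%:R <= n%:R by exists q; rewrite ler_piMl // ltW.
case: (ex_minnP ex) => m am mmin; exists m.
have mq : (m <= q)%N by apply: mmin; rewrite ler_piMl // ltW.
have mD D : (D%:R / q%:R < a) = (D < m)%N.
  rewrite ltr_pdivrMr //; apply/idP/idP => [lt|].
    by rewrite -(ltr_nat R); apply: lt_le_trans lt am.
  by apply: contraTT; rewrite -leNgt -leqNgt; exact: mmin.
split=> //.
  rewrite ler_pdivlMr // am /= ler_pdivrMr // mulrDl mulVf ?gt_eqF //.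
  case: (m) mD => [|n] mD; first by rewrite addr_ge0 // mulr_ge0 // ltW.
  by rewrite -natr1 lerD2r ltW // -ltr_pdivrMr // mD.
move=> a1'; apply/eqP; rewrite eqn_leq mq /= -[q]prednK // -mD a1' ltr_pdivrMr //.
by rewrite mul1r ltr_nat prednK.
Qed.

Lemma norm_real_complex (R : rcfType) (x : R) : `|x%:C| = `|x|%:C.
Proof. by rewrite normc_def /= expr0n addr0 sqrtr_sqr. Qed.

Section DigitalPointSet.
Variables (R : realType) (F : finFieldType) (p k : nat).
Hypotheses (p_prime : prime p) (k_gt0 : (0 < k)%N) (cardF : #|F| = (p ^ k)%N).
Let pF : p \in [pchar F] := card_finPcharP cardF p_prime.
Variable b : k.-tuple (pPrimeCharType pF).
Hypothesis b_basis : basis_of fullv b.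
Local Notation q := (p ^ k)%N.

(** The order is reversed because the first basis vector carries the leading digit, of weight
    [p^-1], while [of_digits] starts from the least significant one. Indices out of range get the
    default 0. *)
Definition basis_digit (z : F) (j : nat) : nat :=
  if insub j is Some i then (coord b (rev_ord i) z : nat) else 0%N.
Definition basis_elem (j : nat) : F :=
  if insub j is Some i then b`_(@rev_ord k i) else 0.

Lemma basis_digit_lt z j : (basis_digit z j < p)%N.
Proof.
rewrite /basis_digit; case: insub => [i|]; last exact: prime_gt0.
by rewrite -[X in (_ < X)%N](Fp_cast p_prime) ltn_ord.
Qed.

Lemma basis_digitE z : z = \sum_(j < k) (basis_digit z j)%:R * basis_elem j.
Proof.
rewrite {1}(coord_basis b_basis (memvf (z : pPrimeCharType pF))).
rewrite [LHS](reindex_inj rev_ord_inj); apply: eq_bigr => j _.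
by rewrite /basis_digit /basis_elem valK.
Qed.

Lemma digital_coordE z :
  digital_coord R b z = (digit_num p k basis_digit z)%:R / q%:R.
Proof.
rewrite /digital_coord /digit_num /of_digits natr_sum mulr_suml.
rewrite [LHS](reindex_inj rev_ord_inj); apply: eq_bigr => j _.
rewrite /basis_digit valK natrM -mulrA; congr (_ * _).
have p0 : (p%:R : R) != 0 by rewrite pnatr_eq0 -lt0n prime_gt0.
apply: (@mulIf _ (p%:R ^+ (rev_ord j).+1)); first by rewrite expf_neq0.
rewrite mulVf ?expf_neq0 // mulrAC natrX -exprD natrX /= subnSK //.
by rewrite addnC subnK ?divff ?expf_neq0 // ltnW.
Qed.

Lemma digital_discrepancy_le (J : finType) (s : nat) (z : J -> 'rV[pPrimeCharType pF]_s)
    (u : {set 'I_s}) (B : R) (al : 'rV[R]_s) : (0 < #|J|)%N -> 0 <= B ->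
  (forall f : {ffun 'I_s -> F}, f != [ffun=> 0] -> (forall i, i \notin u -> f i = 0) ->
     `|\sum_n add_char p k (zeta_p R p) (\sum_i f i * (z n 0 i : F))| <= B%:C) ->
  unit_cube al ->
  `|local_discrepancy (digital_points R b z) (anchor u al)| <=
    #|u|%:R / q%:R + Tfun R p k #|u| * (B / #|J|%:R).
Proof.
move=> J0 B0 hB al01.
have q0 : (0 < q)%N by rewrite expn_gt0 prime_gt0.
pose a i := anchor u al 0 i.
have aE i : a i = if i \in u then al 0 i else 1 by rewrite /a mxE.
have a01 i : 0 <= a i <= 1 by rewrite aE; case: ifP => _; [exact: al01|rewrite ler01 lexx].
have [m mP] := choice (fun i => round_up q0 (a01 i)).
have m_le i : (m i <= q)%N by case: (mP i).
have m_u i : i \notin u -> m i = q.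
  by move=> /negPf iu; case: (mP i) => _ _ _; apply; rewrite aE iu.
pose cnt := #|[set n | [forall i, (digit_num p k basis_digit (z n 0%R i) < m i)%N]]|.
have cntE : #|[set n : J | [forall i, 0 <= digital_points R b z n 0 i < anchor u al 0 i]]| = cnt.
  apply: eq_card => n; rewrite !inE; apply: eq_forallb => i.
  rewrite mxE digital_coordE divr_ge0 ?ler0n //=.
  by case: (mP i) => _ -> _ _.
pose vol : R := \prod_i ((m i)%:R / q%:R).
have box : `|cnt%:R - #|J|%:R * vol| <= (1 + k%:R * kappa R p) ^+ #|u| * B.
  have kap : \sum_(c < p | (0 < c)%N) (csc R p c)%:C <= p%:R * (kappa R p)%:C.
    by rewrite -rmorph_sum -(rmorph_nat (real_complex R)) -rmorphM lecR csc_sum_le.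
  have := @box_count_bound F _ p k pF k_gt0 cardF (zeta_p R p) (kappa R p)%:C
    (fun c => (csc R p c)%:C) (zeta_prim R p_prime)
    (fun c m' cp => zeta_geometric R p_prime m' cp) kap basis_digit basis_elem
    basis_digit_lt basis_digitE J s (fun n i => z n 0 i) u m B%:C m_le m_u hB.
  rewrite (_ : 0 = 0%:C) // lecR => /(_ B0).
  have -> : #|[set n | [forall i, (digit_num p k basis_digit (z n 0%R i) < m i)%N]]|%:R -
      #|J|%:R * \prod_i ((m i)%:R / q%:R) = (cnt%:R - #|J|%:R * vol)%:C.
    rewrite rmorphB rmorphM rmorph_prod /= !(rmorph_nat (real_complex R)).
    congr (_ - _ * _); apply: eq_bigr => i _.
    by rewrite fmorph_div /= !(rmorph_nat (real_complex R)).
  rewrite norm_real_complex.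
  have -> : (1 + k%:R * (kappa R p)%:C) ^+ #|u| * B%:C =
      ((1 + k%:R * kappa R p) ^+ #|u| * B)%:C.
    by rewrite rmorphM rmorphXn rmorphD rmorph1 rmorphM /= (rmorph_nat (real_complex R)).
  by rewrite lecR.
have NC : (0 : R) < #|J|%:R by rewrite ltr0n.
(* Rounding leaves the point count unchanged, so the discrepancy is that of the grid box plus the
   change of volume. *)
have discE : local_discrepancy (digital_points R b z) (anchor u al) =
    (cnt%:R - #|J|%:R * vol) / #|J|%:R + (vol - \prod_i a i).
  by rewrite /local_discrepancy cntE -/(a _); field; rewrite gt_eqF.
have volB : `|vol - \prod_i a i| <= #|u|%:R / q%:R.
  have /andP[d0 dS] : 0 <= vol - \prod_i a i <= \sum_i ((m i)%:R / q%:R - a i).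
    apply: prod_diff_le => i; last first.
      by rewrite ler_pdivrMr ?ltr0n // mul1r ler_nat.
    by case: (mP i) => _ _ /andP[-> _] _; rewrite andbT; have /andP[] := a01 i.
  rewrite ger0_norm //; apply: le_trans dS _.
  rewrite (bigID (mem u)) /= [X in _ + X]big1 ?addr0 => [|i iu]; last first.
    by rewrite m_u // aE (negPf iu) divff ?subrr // pnatr_eq0 -lt0n.
  rewrite mulr_natl -sumr_const; apply: ler_sum => i _.
  by case: (mP i) => _ _ /andP[_ mi] _; rewrite lerBlDl.
rewrite discE addrC; apply: le_trans (ler_normD _ _) _; apply: lerD => //.
rewrite normrM normfV [`|#|J|%:R|]ger0_norm ?ler0n // mulrA ler_pM2r ?invr_gt0 //.
apply: le_trans box _; rewrite ler_wpM2r //.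
exact: kappa_Tfun.
Qed.

End DigitalPointSet.

Section InversivePointSet.
Variables (R : realType) (F : finFieldType) (p k s : nat).
Hypotheses (p_prime : prime p) (k_gt0 : (0 < k)%N) (cardF : #|F| = (p ^ k)%N).
Let pF : p \in [pchar F] := card_finPcharP cardF p_prime.
Variable b : k.-tuple (pPrimeCharType pF).
Hypothesis b_basis : basis_of fullv b.
Variables (v : 'I_s -> F) (gamma : {set 'I_s} -> R).
Hypothesis gamma_ge0 : forall u : {set 'I_s}, u != finset.set0 -> 0 <= gamma u.
Local Notation q := (p ^ k)%N.
Local Notation sq := (Num.sqrt q%:R : R).

(** A frequency supported in [u] produces at most [#|u|] poles, hence a sum of at most
    [3 * #|u| * sqrt q]. The rounding error carries the same factor [#|u|], which is why it can be
    taken out of both terms. *)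
Lemma weighted_star_discrepancy_inversive (J : finType) (w : J -> F) : (0 < #|J|)%N ->
  (forall f : 'I_s -> F, (0 < #|[pred i | f i != 0%R]|)%N ->
     `|\sum_n add_char p k (zeta_p R p) (inv_sum v f (w n))| <=
       (3 * #|[pred i | f i != 0]|)%:R * sq%:C) ->
  weighted_star_discrepancy gamma
    (digital_points R b (fun n => inversive_vector v (w n))) <=
  \big[Num.max/0]_(u : {set 'I_s} | u != finset.set0)
    (gamma u * #|u|%:R * (1 / q%:R + 3 * Tfun R p k #|u| * sq / #|J|%:R)).
Proof.
move=> J0 hw; rewrite /weighted_star_discrepancy; apply: le_bigmax2 => u u0.
rewrite -mulrA ler_wpM2l ?gamma_ge0 //; apply: ge_sup.
  exists `|local_discrepancy (digital_points R b (fun n => inversive_vector v (w n)))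
    (anchor u 0)|, 0 => // i.
  by rewrite mxE lexx ler01.
move=> _ [al al01 <-].
have sq0 : 0 <= sq by exact: sqrtr_ge0.
have B0 : 0 <= (3 * #|u|)%:R * sq by rewrite mulr_ge0.
have := @digital_discrepancy_le R F p k p_prime k_gt0 cardF b b_basis J s
  (fun n => inversive_vector v (w n)) u ((3 * #|u|)%:R * sq) al J0 B0.
move=> H; apply: le_trans (H _ al01) _ => [f f0 fu|].
  have m0 : (0 < #|[pred i | f i != 0%R]|)%N.
    rewrite lt0n; apply: contra f0 => /eqP/card0_eq f0; apply/eqP/ffunP => i.
    by rewrite ffunE; have := f0 i; rewrite inE => /negbFE/eqP.
  under eq_bigr => n _ do under eq_bigr => i _ do rewrite mxE.
  apply: le_trans (hw f m0) _.
  have sqC0 : 0 <= sq%:C by rewrite (_ : 0 = 0%:C) // lecR.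
  rewrite rmorphM /= (rmorph_nat (real_complex R)) ler_wpM2r // ler_nat leq_mul2l /=.
  apply: subset_leq_card; apply/fintype.subsetP => i; rewrite inE.
  by apply: contraNT => /fu ->.
rewrite le_eqVlt; apply/orP; left; apply/eqP.
have q0 : (q%:R : R) != 0 by rewrite pnatr_eq0 -lt0n expn_gt0 prime_gt0.
have N0 : (#|J|%:R : R) != 0 by rewrite pnatr_eq0 -lt0n.
by rewrite natrM; field; rewrite q0 N0.
Qed.

End InversivePointSet.

Theorem theorem1 (R : realType) (F : finFieldType) (p k s : nat)
    (p_prime : prime p) (k_gt0 : (0 < k)%N) (cardF : #|F| = (p ^ k)%N)
    (b : k.-tuple (pPrimeCharType (card_finPcharP cardF p_prime)))
    (b_basis : basis_of fullv b)
    (s_bounds : (1 <= s <= p ^ k)%N)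
    (v : 'I_s -> F) (v_inj : injective v)
    (gamma : {set 'I_s} -> R)
    (gamma_ge0 : forall u : {set 'I_s}, u != finset.set0 -> 0 <= gamma u) :
  let q : R := (p ^ k)%:R in
  (weighted_star_discrepancy gamma (inversive_points R b v)
     <= \big[Num.max/0]_(u : {set 'I_s} | u != finset.set0)
          (gamma u * #|u|%:R *
           (1 / q + 3 * Tfun R p k #|u| / Num.sqrt q)))
  /\
  (forall (theta : F) (T : nat), theta != 0 -> T.-primitive_root theta ->
   weighted_star_discrepancy gamma (inversive_points_period R b v theta (T := T))
     <= \big[Num.max/0]_(u : {set 'I_s} | u != finset.set0)
          (gamma u * #|u|%:R *
           (1 / q + 3 * Tfun R p k #|u| * Num.sqrt q / T%:R))).
Proof.
have pF := card_finPcharP cardF p_prime.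
have q_gt0 : (0 : R) < (p ^ k)%:R by rewrite ltr0n expn_gt0 prime_gt0.
have sq_gt0 : 0 < (Num.sqrt (p ^ k)%:R : R)%:C by rewrite (_ : 0 = 0%:C) // ltcR sqrtr_gt0.
have sq2 : (Num.sqrt (p ^ k)%:R : R)%:C ^+ 2 = (p ^ k)%:R.
  by rewrite -rmorphXn /= sqr_sqrtr ?ltW // (rmorph_nat (real_complex R)).
have zp := zeta_prim R p_prime.
split=> [|theta T th0 thT].
  have F0 : (0 < #|F|)%N by rewrite cardF expn_gt0 prime_gt0.
  have := weighted_star_discrepancy_inversive k_gt0 b_basis gamma_ge0 F0
    (fun f m0 => inv_sum_full pF k_gt0 cardF (@archi_complex R) zp sq_gt0 sq2 v_inj m0).
  rewrite cardF; congr (_ <= _); apply: eq_bigr => u _; congr (_ * (_ + _)).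
  (* For [N = q] the factor [sqrt q / N] is [1 / sqrt q]. *)
  rewrite -mulrA; congr (_ * _); rewrite -[X in _ / X]sqr_sqrtr ?ltW //.
  by rewrite expr2 invfM mulrA divff ?mul1r // gt_eqF // sqrtr_gt0.
have T0 : (0 < #|'I_T|)%N by rewrite card_ord; exact: prim_order_gt0 thT.
have := weighted_star_discrepancy_inversive k_gt0 b_basis gamma_ge0 T0
  (fun f m0 => inv_sum_period pF k_gt0 cardF (@archi_complex R) zp sq_gt0 sq2 v_inj m0 th0 thT).
by rewrite card_ord.
Qed.
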